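(* Let $p\ge1$ and let $F=f+\psi$ be as in the context, with $p$th derivative of $f$ Lipschitz continuous with constant $L_p>0$. Let the sequence $\{\zeta_k\}_{k\ge1}$ be chosen according to the rule $$\zeta_k:=\frac{c}{k^{p+2}}$$ with some $c\ge0$. Then for the iterates $\{x_k\}_{k\ge1}$ produced by the Accelerated Scheme (described in the context) it holds, for all $k\ge1$, $$F(x_k)-F^*\;\le\;O\Bigl(\frac{L_p\bigl(\|x_0-x^*\|^{p+1}+c\bigr)}{k^{p+1}}\Bigr).$$ Moreover (for $c>0$), for every $k\ge0$, in order to find $v_{k+1}$ satisfying $h_{k+1}(v_{k+1})-h_{k+1}^*\le\zeta_{k+1}$ by Monotone Inexact Tensor Method II applied to the minimization of $h_{k+1}$ and started from $v_k$ (described in the context, with suitable choice of its parameters $c'$ and $\delta_1$), it is enough to perform no more than $$O\Bigl(\log\frac{(k+1)\bigl(\|x_0-x^*\|^{p+1}+c\bigr)}{c}\Bigr)$$ inexact monotone tensor steps.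
   Context: Setting. $\mathbb{E}$ is a finite-dimensional real vector space with dual $\mathbb{E}^*$, and $\langle s,x\rangle$ is the value of $s\in\mathbb{E}^*$ at $x\in\mathbb{E}$. $B:\mathbb{E}\to\mathbb{E}^*$ is a fixed symmetric positive definite linear operator and $\|x\|=\langle Bx,x\rangle^{1/2}$. For a $p$-linear symmetric form, $\|D^pf(x)\|=\max_{\|h_i\|\le 1}D^pf(x)[h_1,\dots,h_p]$; $D^kf(x)[h]^k$ denotes the $k$th directional derivative along $h$ taken $k$ times. Problem: minimize $F(x)=f(x)+\psi(x)$ over $x\in\mathbb{E}$, where $\psi:\mathbb{E}\to\mathbb{R}\cup\{+\infty\}$ is proper closed convex and $f:\operatorname{dom}\psi\to\mathbb{R}$ is convex and (sufficiently many times, at least $p$ times) differentiable. A solution $x^*\in\operatorname{dom}\psi$ is assumed to exist and is fixed; $F^*=F(x^* )$. Lipschitz assumption: $\|D^pf(x)-D^pf(y)\|\le L_p\|x-y\|$ for all $x,y\in\operatorname{dom}\psi$. Accelerated Scheme. Choose $x_0\in\operatorname{dom}\psi$; set $v_0:=x_0$, $A_0:=0$. Let $A_k:=\frac{k^{p+1}}{L_p}$ and $a_k:=A_k-A_{k-1}$ for $k\ge1$. Let $d(x):=\frac1{p+1}\|x-x_0\|^{p+1}$ and let $\beta_d(v;x):=d(x)-d(v)-\langle\nabla d(v),x-v\rangle$ be its Bregman divergence. For $k=0,1,2,\dots$: define $$h_{k+1}(x):=A_{k+1}f\Bigl(\frac{a_{k+1}x+A_kx_k}{A_{k+1}}\Bigr)+a_{k+1}\psi(x)+\beta_d(v_k;x),\qquad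 h_{k+1}^*:=\min_x h_{k+1}(x);$$ given $\zeta_{k+1}\ge0$, find any $v_{k+1}$ with $h_{k+1}(v_{k+1})-h_{k+1}^*\le\zeta_{k+1}$, and set $x_{k+1}:=\frac{a_{k+1}v_{k+1}+A_kx_k}{A_{k+1}}$. Inner method (Monotone Inexact Tensor Method II for $h=h_{k+1}$). Write $h=g+\phi$ with smooth part $g(x)=A_{k+1}f\bigl(\frac{a_{k+1}x+A_kx_k}{A_{k+1}}\bigr)$ and composite part $\phi(x)=a_{k+1}\psi(x)+\beta_d(v_k;x)$. The $p$th derivative of $g$ is Lipschitz with constant $L_p(g)=\frac{a_{k+1}^{p+1}}{A_{k+1}^p}L_p$, and $h$ is uniformly convex of degree $p+1$ with constant $\sigma=2^{1-p}$. Put $\omega=\max\{\frac{(p+1)^2L_p(g)}{p!\,\sigma},1\}$ and fix $H:=pL_p(g)$. Let $$\Omega_H(x;y)=g(x)+\sum_{i=1}^p\frac1{i!}D^ig(x)[y-x]^i+\frac{H\|y-x\|^{p+1}}{(p+1)!}+\phi(y).$$ An inexact monotone tensor step from $x$ with accuracy $\delta$ produces any $M\in\operatorname{dom}\psi$ with $\Omega_H(x;M)-\min_y\Omega_H(x;y)\le\delta$ and $h(M)<h(x)$. Starting from $z_0:=v_k$, the method computes $z_{j}$ from $z_{j-1}$ ($j\ge1$) by an inexact monotone tensor step with accuracy $\delta_j$, where $\delta_1\ge0$ is a parameter and $\delta_j:=c'\cdot\bigl(h(z_{j-2})-h(z_{j-1})\bigr)$ for $j\ge2$, with a parameter $0\le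 c'<\frac{p}{p+1}\omega^{-1/p}$. It stops as soon as the current point $z_j$ satisfies $h(z_j)-h^*\le\zeta_{k+1}$, and then $v_{k+1}:=z_j$. Convention: $O(\cdot)$ hides constants depending only on $p$; in the bound on the number of steps, $O(\log t)$ means at most $C(1+\log t)$ with $C$ depending only on $p$. *)

(* Defs.v *)
From HB Require Import structures.
From mathcomp Require Import all_boot all_order all_algebra.
From mathcomp Require Import all_classical all_reals all_analysis.
From mathcomp Require Import ring lra.
Set Implicit Arguments.
Unset Strict Implicit.
Unset Printing Implicit Defensive.
Import Order.TTheory GRing.Theory Num.Theory.
Import numFieldNormedType.Exports.
Local Open Scope classical_set_scope.
Local Open Scope ring_scope.

Section Space.
Context {R : realType} {E : vectType R}.

(* The dual space E^* is 'Hom(E, R^o), and <s, x> is s x. *)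
Definition sym_posdef (B : 'Hom(E, 'Hom(E, R^o))) : Prop :=
  (forall x y : E, B x y = B y x) /\ (forall x : E, x != 0 -> 0 < B x x).

Definition Bnorm (B : 'Hom(E, 'Hom(E, R^o))) (x : E) : R := Num.sqrt (B x x).

Definition edom (psi : E -> \bar R) : set E := [set x | (psi x < +oo)%E].

Definition eproper (psi : E -> \bar R) : Prop :=
  (forall x, psi x != -oo%E) /\ (exists x, edom psi x).

(* The epigraph {(x, t) | psi x <= t} contains its limit points in E x R. *)
Definition closed_epigraph B (psi : E -> \bar R) : Prop :=
  forall (x : E) (t : R),
    (forall eps : R, 0 < eps -> exists (y : E) (s : R),
        [/\ (psi y <= s%:E)%E, Bnorm B (y - x) < eps & `|s - t| < eps]) ->
    (psi x <= t%:E)%E.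

Definition econvex (psi : E -> \bar R) : Prop :=
  forall (t : R) (x y : E), 0 <= t <= 1 ->
    (psi (t *: x + (1 - t) *: y)%R <= t%:E * psi x + (1 - t)%:E * psi y)%E.

(* [Df x [:: h1; ..; hi]] stands for D^i f(x)[h1, .., hi], for i <= p.  Since
   the domain D need not be open, the derivatives are relative to D: the
   increments are taken in D only, and the forms are part of the data.
   In finite dimension, differentiability of the i-form-valued map
   y |-> D^i f(y) amounts to that of y |-> D^i f(y)[hs] for each hs. *)
Definition derivatives_on B (D : set E) (p : nat) (f : E -> R)
    (Df : E -> seq E -> R) : Prop :=
  forall x, D x ->
  [/\ Df x [::] = f x,
      forall (s1 s2 : seq E) (a : R) (u w : E), (size s1 + size s2 < p)%N ->
        Df x (s1 ++ (a *: u + w) :: s2)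
          = a * Df x (s1 ++ u :: s2) + Df x (s1 ++ w :: s2),
      forall s1 s2 : seq E, (size s1 <= p)%N -> perm_eq s1 s2 ->
        Df x s1 = Df x s2 &
      forall hs : seq E, (size hs < p)%N ->
        forall eps : R, 0 < eps -> exists2 r : R, 0 < r &
          forall y, D y -> Bnorm B (y - x) < r ->
            `|Df y hs - Df x hs - Df x ((y - x) :: hs)|
              <= eps * Bnorm B (y - x)].

Definition form_norm B (p : nat) (T : seq E -> R) : \bar R :=
  ereal_sup [set (T hs)%:E | hs in
    [set hs : seq E | size hs = p /\ forall h, h \in hs -> Bnorm B h <= 1]].

Definition lipschitz_derivative B (D : set E) (p : nat) (Df : E -> seq E -> R)
    (L : R) : Prop :=
  forall x y, D x -> D y ->
    (form_norm B p (fun hs => Df x hs - Df y hs)%R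
       <= (L * Bnorm B (x - y))%:E)%E.

Definition composite (f : E -> R) (psi : E -> \bar R) (x : E) : \bar R :=
  ((f x)%:E + psi x)%E.

Definition is_solution (psi F : E -> \bar R) (xs : E) : Prop :=
  edom psi xs /\ forall x, (F xs <= F x)%E.

Definition min_value (h : E -> \bar R) : \bar R := ereal_inf (range h).

(* h(x) - h^* <= eps; this forces h^* to be finite and h x < +oo. *)
Definition subopt (h : E -> \bar R) (eps : \bar R) (x : E) : Prop :=
  (h x - min_value h <= eps)%E.

Definition prox B (p : nat) (x0 x : E) : R :=
  Bnorm B (x - x0) ^+ p.+1 / p.+1%:R.

(* <grad d(v), u> is the derivative of d at v along u. *)
Definition bregman (d : E -> R) (v x : E) : R :=
  d x - d v - derive1 (fun t : R => d (v + t *: (x - v))) 0.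

Section TensorMethod.
Variables (B : 'Hom(E, 'Hom(E, R^o))) (p : nat) (H : R).
Variables (g : E -> R) (Dg : E -> seq E -> R) (phi : E -> \bar R).
Variables (c' delta1 : R).

Definition tensor_model (x y : E) : \bar R :=
  ((g x + (\sum_(1 <= i < p.+1) Dg x (nseq i (y - x)) / i`!%:R)
    + H * Bnorm B (y - x) ^+ p.+1 / p.+1`!%:R)%:E + phi y)%E.

Definition tensor_step (delta : \bar R) (x M : E) : Prop :=
  [/\ edom phi M, subopt (tensor_model x) delta M &
      (composite g phi M < composite g phi x)%E].

(* The accuracy of the step from z_j to z_(j+1), called delta_(j+1). *)
Definition tensor_accuracy (z : nat -> E) (j : nat) : \bar R :=
  if j is i.+1 then
    (c'%:E * (composite g phi (z i) - composite g phi (z i.+1)))%E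
  else delta1%:E.

(* z_0, .., z_n are the first points of a run which has not stopped before
   reaching z_n. *)
Definition tensor_run (zeta : R) (z0 : E) (n : nat) (z : nat -> E) : Prop :=
  z 0 = z0 /\
  forall j, (j < n)%N ->
    ~ subopt (composite g phi) zeta%:E (z j) /\
    tensor_step (tensor_accuracy z j) (z j) (z j.+1).

End TensorMethod.

Section Scheme.
Variables (B : 'Hom(E, 'Hom(E, R^o))) (p : nat) (Lp : R).
Variables (f : E -> R) (Df : E -> seq E -> R) (psi : E -> \bar R).

Definition accA (k : nat) : R := k%:R ^+ p.+1 / Lp.
Definition acca (k : nat) : R := accA k - accA k.-1.

Definition acc_point (x : nat -> E) (k : nat) (y : E) : E :=
  (accA k.+1)^-1 *: (acca k.+1 *: y + accA k *: x k).

Definition sub_smooth (x : nat -> E) (k : nat) (y : E) : R :=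
  accA k.+1 * f (acc_point x k y).

(* Chain rule for the affine substitution y |-> acc_point x k y, see
   [sub_smooth_derivatives]. *)
Definition sub_smooth_D (x : nat -> E) (k : nat) (y : E) (hs : seq E) : R :=
  accA k.+1 *
    Df (acc_point x k y) [seq (acca k.+1 / accA k.+1) *: h | h <- hs].

Definition sub_comp (x v : nat -> E) (k : nat) (y : E) : \bar R :=
  ((acca k.+1)%:E * psi y + (bregman (prox B p (x 0%N)) (v k) y)%:E)%E.

Definition sub_obj (x v : nat -> E) (k : nat) : E -> \bar R :=
  composite (sub_smooth x k) (sub_comp x v k).

(* x_0, v_0, .., x_n, v_n are produced by the first n steps of the scheme. *)
Definition accelerated_scheme (zeta : nat -> R) (n : nat) (x v : nat -> E) :
    Prop :=
  [/\ edom psi (x 0%N), v 0%N = x 0%N &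
      forall k, (k < n)%N ->
        subopt (sub_obj x v k) (zeta k.+1)%:E (v k.+1) /\
        x k.+1 = acc_point x k (v k.+1)].

Definition sub_Lp (k : nat) : R := acca k.+1 ^+ p.+1 / accA k.+1 ^+ p * Lp.

(* The constant of uniform convexity is 2^(1-p), with p >= 1. *)
Definition sub_omega (k : nat) : R :=
  Num.max (p.+1%:R ^+ 2 * sub_Lp k / (p`!%:R * 2 ^- p.-1)) 1.

End Scheme.
End Space.

Lemma BnormZ (R : realType) (E : vectType R) (B : 'Hom(E, 'Hom(E, R^o)))
    (a : R) (x : E) : 0 <= a -> Bnorm B (a *: x) = a * Bnorm B x.
Proof.
move=> a0; have -> : Bnorm B (a *: x) = Num.sqrt (a ^+ 2 * B x x).
  rewrite /Bnorm; congr Num.sqrt.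
  have -> : B (a *: x) = a *: B x by rewrite linearZ.
  by rewrite scale_lfunE linearZ /= expr2 -mulrA.
by rewrite sqrtrM ?sqr_ge0// sqrtr_sqr ger0_norm.
Qed.

Lemma accA_gt0 (R : realType) (p : nat) (Lp : R) k :
  0 < Lp -> 0 < accA p Lp k.+1.
Proof. by move=> L0; rewrite /accA divr_gt0// exprn_gt0// ltr0n. Qed.

Lemma acca_gt0 (R : realType) (p : nat) (Lp : R) k :
  0 < Lp -> 0 < acca p Lp k.+1.
Proof.
move=> L0; rewrite /acca /accA /= -mulrBl divr_gt0// subr_gt0 ltrXn2r//.
by rewrite ltr_nat.
Qed.

Lemma sub_smooth_derivatives (R : realType) (E : vectType R)
    (B : 'Hom(E, 'Hom(E, R^o))) (p : nat) (Lp : R) (D : set E) (f : E -> R)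
    (Df : E -> seq E -> R) (x : nat -> E) (k : nat) :
  0 < Lp -> (forall y, D y -> D (acc_point p Lp x k y)) ->
  derivatives_on B D p f Df ->
  derivatives_on B D p (sub_smooth p Lp f x k) (sub_smooth_D p Lp Df x k).
Proof.
move=> L0 DD dfD y Dy; have [f0 flin fsym fder] := dfD _ (DD _ Dy).
have A0 := accA_gt0 p k L0; have a0 := acca_gt0 p k L0.
have t0 : 0 < acca p Lp k.+1 / accA p Lp k.+1 by rewrite divr_gt0.
split.
- by rewrite /sub_smooth_D /= f0.
- move=> s1 s2 a u w ss; rewrite /sub_smooth_D !map_cat /=.
  move: (acca p Lp k.+1 / accA p Lp k.+1) => t.
  have -> : t *: (a *: u + w) = a *: (t *: u) + t *: w.
    by rewrite scalerDr !scalerA mulrC.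
  by rewrite flin ?size_map// mulrDr mulrCA.
- move=> s1 s2 ss pe; rewrite /sub_smooth_D (fsym _ _ _ (perm_map _ pe))//.
  by rewrite size_map.
- move=> hs shs eps e0; set t := _ / _ in t0.
  have e'0 : 0 < eps / (accA p Lp k.+1 * t) by rewrite divr_gt0// mulr_gt0.
  have shs' : (size [seq t *: h | h <- hs] < p)%N by rewrite size_map.
  have [r r0 hr] := fder _ shs' _ e'0.
  exists (r / t); first by rewrite divr_gt0.
  move=> z Dz zr; have := hr _ (DD _ Dz).
  have -> : acc_point p Lp x k z - acc_point p Lp x k y = t *: (z - y).
    rewrite /acc_point -scalerBr opprD addrACA subrr addr0 -scalerBr scalerA.
    by rewrite mulrC.
  move: zr; rewrite ltr_pdivlMr// mulrC => zr.
  rewrite BnormZ ?(ltW t0)// => /(_ zr) h.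
  rewrite /sub_smooth_D /= -/t -!mulrBr normrM (gtr0_norm A0).
  apply: le_trans (ler_wpM2l (ltW A0) h) _.
  have key (a b e n : R) : 0 < a -> 0 < b ->
      a * (e / (a * b) * (b * n)) = e * n.
    by move=> ? ?; field; rewrite !gt_eqF.
  by rewrite key.
Qed.

(* Main.v *)
Require Import Defs.
From mathcomp Require Import all_boot all_order all_algebra.
From mathcomp Require Import all_classical all_reals all_analysis.
From mathcomp Require Import ring lra.
Set Implicit Arguments.
Unset Strict Implicit.
Unset Printing Implicit Defensive.
Import Order.TTheory GRing.Theory Num.Theory.
Import numFieldNormedType.Exports.
Local Open Scope classical_set_scope.
Local Open Scope ring_scope.

(** An approximate minimizer [v'] of a convex function plus the prox-function
    [d] still satisfies the three-point inequality
    [h v' + beta_d(v'; y) <= h y + error]: comparing [v'] with [v' + t (y - v')]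
    costs [zeta / t] for the inexactness and [O(t)] for the smoothness of [d]
    along the segment.  With [t] of order [k ^ (- 3/2)] the errors are summable
    relatively to the potential [A_k (F x_k - min F) + beta_d(v_k; xstar)], which
    therefore stays [O(|x_0 - xstar| ^ (p+1) + c)].

    For the inner method, the Taylor bound and the uniform convexity of [d]
    (used at midpoints, so that no minimizer has to exist) show that every
    tensor step reduces the residual by a factor depending only on [p], up to
    its accuracy.  The initial residual may be arbitrarily large, but after one
    step it is controlled by the distance from [v_k] to near-minimizers of
    [h_(k+1)], which the potential bounds; the second step, whose accuracy
    involves the initial residual, is only known to be monotone, and the
    geometric decrease starts with the third one. *)

(** * Scalar inequalities *)

Section PowerGap.
Context {R : realType}.
Implicit Types (a b M n : R) (p m k : nat).

(** The remainder at [a] of the first-order expansion of [t ^+ p.+1] around [b], that is the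
    one-dimensional Bregman divergence of this power. *)
Definition pow_gap p a b : R :=
  a ^+ p.+1 + p%:R * b ^+ p.+1 - p.+1%:R * b ^+ p * a.

(** This recursion in the degree drives the inductions behind both the lower and the upper estimates
    of the gap. *)
Lemma pow_gapS p a b :
  pow_gap p.+1 a b = b * pow_gap p a b + (a - b) * (a ^+ p.+1 - b ^+ p.+1).
Proof. by rewrite /pow_gap -!natr1 !exprS; ring. Qed.

Lemma subXX_ge k a b : 0 <= a -> 0 <= b ->
  a ^+ k * (a - b) ^+ 2 <= (a - b) * (a ^+ k.+1 - b ^+ k.+1).
Proof.
move=> a0 b0; have -> : (a - b) * (a ^+ k.+1 - b ^+ k.+1)
   = a ^+ k * (a - b) ^+ 2 + b * ((a - b) * (a ^+ k - b ^+ k)).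
  by rewrite !exprS; ring.
rewrite lerDl mulr_ge0//; have [ab|/ltW ba] := leP a b.
  by rewrite mulr_le0// subr_le0// lerXn2r.
by rewrite mulr_ge0// subr_ge0// lerXn2r.
Qed.

Lemma subXX_le k M a b : 0 <= a <= M -> 0 <= b <= M ->
  (a - b) * (a ^+ k.+1 - b ^+ k.+1) <= k.+1%:R * M ^+ k * (a - b) ^+ 2.
Proof.
move=> /andP[a0 aM] /andP[b0 bM]; elim: k => [|k ih].
  by rewrite !expr1 expr0 !mul1r -expr2.
have -> : (a - b) * (a ^+ k.+2 - b ^+ k.+2)
   = a ^+ k.+1 * (a - b) ^+ 2 + b * ((a - b) * (a ^+ k.+1 - b ^+ k.+1)).
  by rewrite !exprS; ring.
rewrite -[k.+2]addn1 natrD addrC.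
have -> : (k.+1%:R + 1%:R) * M ^+ k.+1 * (a - b) ^+ 2
  = M * (k.+1%:R * M ^+ k * (a - b) ^+ 2) + M ^+ k.+1 * (a - b) ^+ 2.
  by rewrite exprS; ring.
have M0 := le_trans a0 aM.
apply: lerD; last by rewrite ler_wpM2r ?sqr_ge0// lerXn2r.
apply: ler_pM => //; apply: le_trans (subXX_ge k a0 b0).
by rewrite mulr_ge0 ?sqr_ge0 ?mulr_ge0 ?ler0n ?exprn_ge0.
Qed.

(** Each step of [pow_gapS] contributes one more [b ^+ m * (a - b) ^+ 2], by [subXX_ge] with the two
    numbers exchanged. The variant [pow_gap_ge_l], weighted by [a], takes over when [b] is small. *)
Lemma pow_gap_ge_r m a b : 0 <= a -> 0 <= b ->
  m.+1%:R * b ^+ m * (a - b) ^+ 2 <= pow_gap m.+1 a b.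
Proof.
move=> a0 b0; elim: m => [|m ih]; first by rewrite /pow_gap; lra.
rewrite pow_gapS; have := subXX_ge m.+1 b0 a0.
have := ler_wpM2l b0 ih; set X := _ - b ^+ m.+2.
have -> : (b - a) * (b ^+ m.+2 - a ^+ m.+2) = (a - b) * X by rewrite /X; ring.
move: X => X; have -> : b ^+ m.+1 * (b - a) ^+ 2 = b * b ^+ m * (a - b) ^+ 2.
  by rewrite exprS; ring.
rewrite [b ^+ m.+1]exprS -[m.+2%:R]natr1; move: (b ^+ m) m.+1%:R => Y k.
by move: (pow_gap _ _ _) => G; lra.
Qed.

Lemma pow_gap_ge_l m a b : 0 <= a -> 0 <= b ->
  a ^+ m * (a - b) ^+ 2 <= pow_gap m.+1 a b.
Proof.
move=> a0 b0; rewrite pow_gapS; apply: le_trans (subXX_ge m a0 b0) _.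
rewrite lerDr mulr_ge0//; case: m => [|m]; first by rewrite /pow_gap; lra.
apply: le_trans (pow_gap_ge_r m a0 b0).
by rewrite mulr_ge0 ?sqr_ge0 ?mulr_ge0 ?ler0n ?exprn_ge0.
Qed.

Lemma pow_gap_ge0 p a b : 0 <= a -> 0 <= b -> 0 <= pow_gap p a b.
Proof.
move=> a0 b0; case: p => [|m]; first by rewrite /pow_gap; lra.
apply: le_trans (pow_gap_ge_r m a0 b0).
by rewrite mulr_ge0 ?sqr_ge0 ?mulr_ge0 ?ler0n ?exprn_ge0.
Qed.

Lemma pow_gap_le m M a b : 0 <= a <= M -> 0 <= b <= M ->
  pow_gap m.+1 a b <= m.+1%:R * m.+2%:R / 2 * M ^+ m * (a - b) ^+ 2.
Proof.
move=> aM bM; have /andP[b0 bM'] := bM; have /andP[a0 _] := aM.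
have M0 := le_trans b0 bM'.
elim: m => [|m ih]; first by rewrite /pow_gap; lra.
rewrite pow_gapS; have := subXX_le m.+1 aM bM.
have : b * pow_gap m.+1 a b
    <= M * (m.+1%:R * m.+2%:R / 2 * M ^+ m * (a - b) ^+ 2).
  by apply: ler_pM => //; exact: pow_gap_ge0.
rewrite (_ : m.+3%:R = m.+1%:R + 2); last by rewrite -natrD addn2.
rewrite (_ : m.+2%:R = m.+1%:R + 1); last by rewrite natr1.
rewrite [M ^+ m.+1]exprS => h1 h2; apply: le_trans (lerD h1 h2) _.
by move: m.+1%:R => x; rewrite le_eqVlt; apply/orP; left; apply/eqP; field.
Qed.

(* For a = |x|, b = |v|, n = |x - v| the middle quantity is the Bregman
   divergence of |.|^(m+2) / (m+2) at v. *)
Lemma pow_bregman_ge m a b n : 0 <= a -> 0 <= b -> `|a - b| <= n -> n <= a + b ->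
  4 ^- m.+1 / m.+2%:R * n ^+ m.+2
   <= pow_gap m.+1 a b / m.+2%:R + b ^+ m * (n ^+ 2 - (a - b) ^+ 2) / 2.
Proof.
move=> a0 b0 abn nab; have n0 : 0 <= n by apply: le_trans abn.
have sq : (a - b) ^+ 2 <= n ^+ 2.
  by rewrite -[X in X <= _]real_normK ?num_real// lerXn2r ?nnegrE.
have m2 : (0 : R) < m.+2%:R by rewrite ltr0n.
have q4 : (0 : R) < 4 ^+ m by rewrite exprn_gt0.
have q4' : (4 : R) ^+ m != 0 by rewrite gt_eqF.
have eq4 : n ^+ m.+2 / 4 ^+ m.+1 = (n / 4) ^+ m * n ^+ 2 / 4.
  by rewrite expr_div_n !exprS; field; rewrite q4'.
have e : 4 ^- m.+1 / m.+2%:R * n ^+ m.+2 = (n / 4) ^+ m * n ^+ 2 / 4 / m.+2%:R.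
  by rewrite -eq4 [RHS]mulrC; ring.
rewrite e.
have n40 : 0 <= n / 4 by rewrite divr_ge0.
have h0 : 0 <= (n / 4) ^+ m * n ^+ 2 by rewrite mulr_ge0 ?exprn_ge0.
(* If [b] is at least [n / 4], the gap compensates the negative term in [(a - b) ^+ 2] and leaves
   [b ^+ m * n ^+ 2 / 2]. Otherwise [n <= a + b] forces [a > 3 n / 4] and [a - b > n / 2], so the
   gap alone, weighted by [a ^+ m], suffices. *)
have [nb|bn] := leP (n / 4) b.
  have g := pow_gap_ge_r m a0 b0.
  have : m.+1%:R * b ^+ m * (a - b) ^+ 2 / m.+2%:R <= pow_gap m.+1 a b / m.+2%:R.
    by rewrite ler_wpM2r// invr_ge0 ltW.
  have : b ^+ m * (a - b) ^+ 2 / 2 <= m.+1%:R * b ^+ m * (a - b) ^+ 2 / m.+2%:R.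
    rewrite -[_ * _ * (a - b) ^+ 2]mulrA ler_pdivlMr//.
    have : 0 <= b ^+ m * (a - b) ^+ 2 by rewrite mulr_ge0 ?sqr_ge0 ?exprn_ge0.
    have : (1 : R) <= m.+1%:R by rewrite ler1n.
    rewrite -[m.+2%:R]natr1; move: m.+1%:R (_ * _) => x Z x1 Z0.
    by have := mulr_ge0 Z0 (_ : 0 <= x - 1); rewrite subr_ge0 => /(_ x1); lra.
  have : (n / 4) ^+ m * n ^+ 2 <= b ^+ m * n ^+ 2.
    by rewrite ler_wpM2r ?exprn_ge0// lerXn2r ?nnegrE.
  have : (n / 4) ^+ m * n ^+ 2 / 4 / m.+2%:R <= (n / 4) ^+ m * n ^+ 2 / 2.
    rewrite -mulrA ler_wpM2l// -[X in _ / X]mulr1 -[2^-1]mul1r.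
    rewrite -invfM mul1r mulr1 lef_pV2 ?posrE ?mulr_gt0//.
    have : (2 : R) <= m.+2%:R by rewrite ler_nat.
    lra.
  rewrite (_ : b ^+ m * (n ^+ 2 - (a - b) ^+ 2) / 2
     = b ^+ m * n ^+ 2 / 2 - b ^+ m * (a - b) ^+ 2 / 2); last by ring.
  move: ((n / 4) ^+ m * n ^+ 2) => Y.
  move=> h4 h3 h2 h1; have := le_trans h2 h1; move: h4 h3 {h2 h1 g e eq4 m2}.
  by move: (Y / 4 / _) (pow_gap _ _ _ / _) (_ * n ^+ 2) (_ * (a - b) ^+ 2) => *; lra.
have hA : n / 2 <= `|a - b|.
  have : n / 2 <= a - b by lra.
  by move=> /le_trans; apply; exact: ler_norm.
have g := pow_gap_ge_l m a0 b0.
have h2 : 0 <= b ^+ m * (n ^+ 2 - (a - b) ^+ 2) / 2.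
  by rewrite divr_ge0// mulr_ge0 ?exprn_ge0// subr_ge0.
apply: (@le_trans _ _ (pow_gap m.+1 a b / m.+2%:R)); last by rewrite lerDl.
rewrite ler_wpM2r ?invr_ge0 ?(ltW m2)//; apply: le_trans g.
rewrite -mulrA; apply: ler_pM; rewrite ?exprn_ge0//.
- by rewrite divr_ge0// exprn_ge0.
- by rewrite lerXn2r ?nnegrE//; lra.
have -> : n ^+ 2 / 4 = (n / 2) ^+ 2 by field.
rewrite -[X in _ <= X]real_normK ?num_real// lerXn2r ?nnegrE ?divr_ge0//.
Qed.

(** Both summands are bounded with the same factor [m.+1 / 2 * M ^+ m], so the terms in
    [(a - b) ^+ 2] cancel. *)
Lemma pow_bregman_le m M a b n : 0 <= a <= M -> 0 <= b <= M -> `|a - b| <= n ->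
  pow_gap m.+1 a b / m.+2%:R + b ^+ m * (n ^+ 2 - (a - b) ^+ 2) / 2
   <= m.+1%:R / 2 * M ^+ m * n ^+ 2.
Proof.
move=> aM bM abn; have /andP[b0 bM'] := bM; have /andP[a0 _] := aM.
have n0 : 0 <= n by apply: le_trans abn.
have sq : (a - b) ^+ 2 <= n ^+ 2.
  by rewrite -[X in X <= _]real_normK ?num_real// lerXn2r ?nnegrE.
have M0 := le_trans b0 bM'.
have m2 : (0 : R) < m.+2%:R by rewrite ltr0n.
have h1 : pow_gap m.+1 a b / m.+2%:R <= m.+1%:R / 2 * M ^+ m * (a - b) ^+ 2.
  rewrite ler_pdivrMr//; apply: le_trans (pow_gap_le m aM bM) _.
  by rewrite le_eqVlt; apply/orP; left; apply/eqP; field.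
have h2 : b ^+ m * (n ^+ 2 - (a - b) ^+ 2) / 2
     <= m.+1%:R / 2 * M ^+ m * (n ^+ 2 - (a - b) ^+ 2).
  rewrite mulrAC ler_wpM2r ?subr_ge0//.
  rewrite mulrAC ler_wpM2r// -[X in X <= _]mul1r.
  by apply: ler_pM; rewrite ?exprn_ge0// ?ler1n// lerXn2r ?nnegrE.
by apply: le_trans (lerD h1 h2) _; rewrite -mulrDr addrC subrK.
Qed.

Lemma exprD_le k a b : 0 <= a -> 0 <= b ->
  (a + b) ^+ k <= 2 ^+ k * (a ^+ k + b ^+ k).
Proof.
wlog ab : a b / a <= b.
  move=> H a0 b0; have [/H|/ltW/H] := leP a b; first exact.
  by rewrite addrC [b ^+ k + _]addrC; exact.
move=> a0 b0; have -> : 2 ^+ k * (a ^+ k + b ^+ k) = 2 ^+ k * a ^+ k + (2 * b) ^+ k.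
  by rewrite exprMn mulrDr.
rewrite -[X in X <= _]add0r lerD ?mulr_ge0 ?exprn_ge0//.
by rewrite lerXn2r ?nnegrE ?addr_ge0 ?mulr_ge0//; lra.
Qed.

End PowerGap.

(** Division-free criterion, in the form in which differentiability is assumed for [f] and proved
    for the prox-function. *)
Lemma is_derive_from_slope {R : realType} (f : R -> R) (t l : R) :
  (forall eps : R, 0 < eps -> exists2 r : R, 0 < r & forall s, `|s - t| < r ->
     `|f s - f t - l * (s - t)| <= eps * `|s - t|) ->
  is_derive t 1 f l.
Proof.
move=> fl.
have dq : h^-1 *: ((f \o shift t) (h *: 1) - f t) @[h --> (0 : R)^'] --> l.
  apply/cvgrPdist_le => e e0; have [r r0 hr] := fl e e0.
  near=> h.
  have h0 : h != 0 by near: h; exact: nbhs_dnbhs_neq.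
  have hr' : `|h| < r.
    near: h; apply: dnbhs0_lt => //.
  have := hr (h + t); rewrite addrK => /(_ hr') H.
  rewrite /= /GRing.scale /= mulr1 distrC.
  have -> : h^-1 * (f (h + t) - f t) - l = h^-1 * (f (h + t) - f t - l * h).
    by field.
  by rewrite normrM normfV mulrC ler_pdivrMr ?normr_gt0.
apply: DeriveDef; last by rewrite /derive; exact: cvg_lim dq.
by rewrite /derivable; apply/cvg_ex; exists l.
Unshelve. all: by end_near. Qed.

(** * The prox-function *)

Section InnerProduct.
Context {R : realType} {E : vectType R} (B : 'Hom(E, 'Hom(E, R^o))).
Hypothesis spB : sym_posdef B.
Local Notation nrm := (Bnorm B).

Lemma BformDl x y z : B (x + y) z = B x z + B y z.
Proof. by rewrite linearD add_lfunE. Qed.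

Lemma BformZl a x z : B (a *: x) z = a * B x z.
Proof. by rewrite linearZ scale_lfunE. Qed.

Lemma BformDr x y z : B z (x + y) = B z x + B z y.
Proof. by rewrite linearD. Qed.

Lemma BformZr a x z : B z (a *: x) = a * B z x.
Proof. by rewrite linearZ. Qed.

Lemma Bform0l z : B 0 z = 0.
Proof. by rewrite -(scale0r (0 : E)) BformZl mul0r. Qed.

Lemma Bform0r z : B z 0 = 0.
Proof. by rewrite spB.1 Bform0l. Qed.

Lemma Bform_ge0 x : 0 <= B x x.
Proof.
have [->|x0] := eqVneq x 0; first by rewrite Bform0l.
exact/ltW/(spB.2 _ x0).
Qed.

Lemma Bnorm_ge0 x : 0 <= nrm x.
Proof. exact: sqrtr_ge0. Qed.

Lemma Bnorm_sq x : nrm x ^+ 2 = B x x.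
Proof. by rewrite sqr_sqrtr// Bform_ge0. Qed.

Lemma Bnorm0 : nrm 0 = 0.
Proof. by rewrite /Bnorm Bform0l sqrtr0. Qed.

Lemma Bnorm_gt0 x : x != 0 -> 0 < nrm x.
Proof. by move=> x0; rewrite sqrtr_gt0 spB.2. Qed.

Lemma BnormN x : nrm (- x) = nrm x.
Proof.
by rewrite /Bnorm -scaleN1r BformZl BformZr mulrA mulrNN !mulr1 mul1r.
Qed.

Lemma BnormB x y : nrm (x - y) = nrm (y - x).
Proof. by rewrite -BnormN opprB. Qed.

Lemma Bnorm_homog a x : nrm (a *: x) = `|a| * nrm x.
Proof.
have [a0|a0] := leP 0 a; first by rewrite BnormZ// ger0_norm.
by rewrite -[a *: x]opprK -scaleNr BnormN BnormZ ?oppr_ge0 ?(ltW a0)// ltr0_norm.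
Qed.

Lemma Bform_le x y : B x y <= nrm x * nrm y.
Proof.
have [->|x0] := eqVneq x 0; first by rewrite Bform0l Bnorm0 mul0r.
have [->|y0] := eqVneq y 0; first by rewrite Bform0r Bnorm0 mulr0.
have := Bform_ge0 (nrm y *: x + (- nrm x) *: y).
rewrite !(BformDl, BformDr, BformZl, BformZr) (spB.1 y x) -!Bnorm_sq => h.
have xy := mulr_gt0 (Bnorm_gt0 x0) (Bnorm_gt0 y0).
rewrite -(ler_pM2l xy); move: h; move: (nrm x) (nrm y) (B x y) => a b c; lra.
Qed.

Lemma Bnorm_triangle x y : nrm (x + y) <= nrm x + nrm y.
Proof.
rewrite -(@ler_pXn2r _ 2) ?nnegrE ?addr_ge0 ?Bnorm_ge0// Bnorm_sq.
rewrite !(BformDl, BformDr) (spB.1 y x) -!Bnorm_sq.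
have := Bform_le x y; move: (nrm x) (nrm y) (B x y) => a b c; lra.
Qed.

Lemma Bnorm_triangleB x y : `|nrm x - nrm y| <= nrm (x - y).
Proof.
have h1 := Bnorm_triangle (x - y) y; have h2 := Bnorm_triangle (y - x) x.
rewrite !subrK in h1 h2; rewrite BnormB in h2.
by rewrite ler_norml; apply/andP; split; lra.
Qed.

Section Bregman.
Variables (m : nat) (x0 : E).
Local Notation d := (prox B m.+1 x0).

(** Explicit gradient of [d], here of degree [m.+2]. It is only a candidate until [bregman_prox]
    identifies it with the derivative that defines [bregman]. *)
Definition prox_grad v u : R := nrm (v - x0) ^+ m * B (v - x0) u.

Definition prox_breg v x : R := d x - d v - prox_grad v (x - v).

(** Splits the divergence into a radial part, depending on the two radii only, and an angular part
    that vanishes when [x - x0] and [v - x0] point the same way. This reduces bounds on [prox_breg]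
    to scalar ones. *)
Lemma prox_breg_gap v x : prox_breg v x =
  pow_gap m.+1 (nrm (x - x0)) (nrm (v - x0)) / m.+2%:R
  + nrm (v - x0) ^+ m * (nrm (x - v) ^+ 2 - (nrm (x - x0) - nrm (v - x0)) ^+ 2) / 2.
Proof.
have m2 : m.+2%:R != 0 :> R by rewrite pnatr_eq0.
have e : nrm (x - v) ^+ 2
    = nrm (x - x0) ^+ 2 - nrm (v - x0) ^+ 2 - 2 * B (v - x0) (x - v).
  have -> : x - x0 = (v - x0) + (x - v) by rewrite [RHS]addrC addrA subrK.
  rewrite !Bnorm_sq; move: (v - x0) (x - v) => w u.
  by rewrite !(BformDl, BformDr) (spB.1 u w); ring.
rewrite /prox_breg /prox_grad /prox /pow_gap e.
rewrite (_ : m.+1%:R = m.+2%:R - 1); last by rewrite -[m.+2%:R]natr1 addrK.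
move: m2; move: (nrm _) (nrm _) (B _ _) m.+2%:R => a b c k k0.
by rewrite !exprS; field.
Qed.

Lemma prox_breg_ge v x :
  4 ^- m.+1 / m.+2%:R * nrm (x - v) ^+ m.+2 <= prox_breg v x.
Proof.
rewrite prox_breg_gap; apply: pow_bregman_ge; rewrite ?Bnorm_ge0//.
  apply: le_trans (Bnorm_triangleB _ _) _.
  by rewrite opprB addrA subrK.
rewrite (BnormB v) (_ : x - v = (x - x0) + (x0 - v)) ?Bnorm_triangle//.
by rewrite addrA subrK.
Qed.

Lemma prox_breg_ge0 v x : 0 <= prox_breg v x.
Proof.
apply: le_trans (prox_breg_ge v x).
by rewrite mulr_ge0 ?exprn_ge0 ?Bnorm_ge0// divr_ge0 ?invr_ge0 ?exprn_ge0 ?ler0n.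
Qed.

Lemma prox_breg_le v x M : nrm (x - x0) <= M -> nrm (v - x0) <= M ->
  prox_breg v x <= m.+1%:R / 2 * M ^+ m * nrm (x - v) ^+ 2.
Proof.
move=> xM vM; rewrite prox_breg_gap; apply: pow_bregman_le; rewrite ?Bnorm_ge0//.
apply: le_trans (Bnorm_triangleB _ _) _.
by rewrite opprB addrA subrK.
Qed.

(** The error of the linear expansion of [d] along the line is itself a [prox_breg], which
    [prox_breg_le] bounds by a multiple of [t ^+ 2]. The norm, singular at 0, is thus never
    differentiated. *)
Lemma bregman_prox v x : bregman d v x = prox_breg v x.
Proof.
rewrite /bregman /prox_breg; congr (_ - _); set u := x - v.
suff : is_derive (0 : R) 1 (fun t : R => d (v + t *: u)) (prox_grad v u).
  by move=> h; rewrite derive1E; exact: derive_val.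
set M := nrm (v - x0) + nrm u; set K := m.+1%:R / 2 * M ^+ m * nrm u ^+ 2.
have M0 : 0 <= M by rewrite addr_ge0 ?Bnorm_ge0.
have K0 : 0 <= K.
  by rewrite mulr_ge0 ?sqr_ge0// mulr_ge0 ?exprn_ge0// mulr_ge0 ?ler0n ?invr_ge0.
apply: is_derive_from_slope => e e0.
exists (Num.min 1 (e / (K + 1))); first by rewrite lt_min ltr01 divr_gt0//; lra.
move=> t; rewrite subr0 lt_min => /andP[t1 te].
rewrite scale0r addr0.
have ev : v + t *: u - v = t *: u by rewrite addrAC subrr add0r.
have eq1 : d (v + t *: u) - d v - prox_grad v u * t = prox_breg v (v + t *: u).
  rewrite /prox_breg ev /prox_grad BformZr; congr (_ - _).
  by rewrite -mulrA [_ * t]mulrC.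
rewrite eq1 ger0_norm ?prox_breg_ge0//.
apply: (@le_trans _ _ (K * t ^+ 2)).
  apply: (le_trans (@prox_breg_le v (v + t *: u) M _ _)).
  - rewrite addrAC; apply: le_trans (Bnorm_triangle _ _) _.
    by rewrite lerD2l Bnorm_homog ler_piMl ?Bnorm_ge0 ?(ltW t1).
  - by rewrite lerDl Bnorm_ge0.
  - rewrite ev Bnorm_homog exprMn real_normK ?num_real//.
    by rewrite [t ^+ 2 * _]mulrC mulrA.
rewrite -real_normK ?num_real// expr2 mulrA ler_wpM2r//.
have : (K + 1) * `|t| <= e by rewrite mulrC -ler_pdivlMr ?(ltW te)//; lra.
by apply: le_trans; rewrite ler_wpM2r// lerDl.
Qed.

End Bregman.
End InnerProduct.

(** * Taylor's formula relative to a convex set *)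

Section Taylor.
Context {R : realType}.
Implicit Types (e : R -> R) (t a M : R).

(* Differentiability relative to [0, 1], hence one-sided at the end points. *)
Definition slope01 (e e1 : R -> R) : Prop :=
  forall t, 0 <= t <= 1 -> forall eps, 0 < eps -> exists2 r : R, 0 < r &
    forall s, 0 <= s <= 1 -> `|s - t| < r ->
      `|e s - e t - e1 t * (s - t)| <= eps * `|s - t|.

Lemma slope01_cst a : slope01 (fun=> a) (fun=> 0).
Proof.
move=> t _ eps e0; exists 1 => // s _ _.
by rewrite subrr mul0r subr0 normr0 mulr_ge0// ltW.
Qed.

Lemma slope01D e e1 f f1 : slope01 e e1 -> slope01 f f1 ->
  slope01 (fun t => e t + f t) (fun t => e1 t + f1 t).
Proof.
move=> he hf t t01 eps eps0; have eps2 : 0 < eps / 2 by rewrite divr_gt0.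
have [r r0 hr] := he _ t01 _ eps2; have [q q0 hq] := hf _ t01 _ eps2.
exists (Num.min r q) => [|s s01]; first by rewrite lt_min r0.
rewrite lt_min => /andP[/hr hr' /hq hq'].
have -> : e s + f s - (e t + f t) - (e1 t + f1 t) * (s - t)
  = (e s - e t - e1 t * (s - t)) + (f s - f t - f1 t * (s - t)) by ring.
apply: le_trans (ler_normD _ _) _; apply: le_trans (lerD (hr' s01) (hq' s01)) _.
by rewrite -mulrDl -splitr.
Qed.

Lemma slope01Z a e e1 : slope01 e e1 ->
  slope01 (fun t => a * e t) (fun t => a * e1 t).
Proof.
move=> he t t01 eps eps0.
have a0 : 0 < `|a| + 1 by rewrite ltr_wpDl.
have [r r0 hr] := he _ t01 _ (divr_gt0 eps0 a0).
exists r => // s s01 st; have {hr} := hr s s01 st.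
rewrite -mulrA -!mulrBr normrM => h; apply: le_trans (ler_wpM2l _ h) _ => //.
rewrite mulrA ler_wpM2r// mulrCA ler_piMr ?ltW// ltr_pdivrMr//.
by rewrite mul1r ltrDl.
Qed.

Lemma slope01_sum n (e e1 : 'I_n -> R -> R) :
  (forall i, slope01 (e i) (e1 i)) ->
  slope01 (fun t => \sum_i e i t) (fun t => \sum_i e1 i t).
Proof.
elim: n e e1 => [|n ih] e e1 h.
  have := slope01_cst 0; congr (slope01 _ _);
  by apply/funext => t; rewrite big_ord0.
have := slope01D (h ord0) (ih _ _ (fun i => h (lift ord0 i))).
by congr (slope01 _ _); apply/funext => t; rewrite big_ord_recl.
Qed.

Lemma slope01_monomial k :
  slope01 (fun t => t ^+ k.+1 / k.+1`!%:R) (fun t => t ^+ k / k`!%:R).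
Proof.
have f0 (j : nat) : 0 < j`!%:R :> R by rewrite ltr0n fact_gt0.
suff : slope01 (fun t => t ^+ k.+1) (fun t => k.+1%:R * t ^+ k).
  move=> /(slope01Z (k.+1`!%:R^-1)); congr (slope01 _ _); apply/funext => t.
    by rewrite mulrC.
  by rewrite factS natrM; field; rewrite (gt_eqF (f0 k)) nat1r pnatr_eq0.
move=> t t01 eps eps0.
case: k => [|k].
  by exists 1 => // s _ _; rewrite !expr1 expr0 !mul1r subrr normr0 mulr_ge0// ltW.
pose K : R := k.+1%:R * k.+2%:R / 2.
have K0 : 0 <= K by rewrite mulr_ge0 ?invr_ge0 ?mulr_ge0.
have K1 : 0 < K + 1 by rewrite ltr_wpDl.
exists (eps / (K + 1)) => [|s s01 st]; first by rewrite divr_gt0.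
have -> : s ^+ k.+2 - t ^+ k.+2 - k.+2%:R * t ^+ k.+1 * (s - t)
   = pow_gap k.+1 s t.
  by rewrite /pow_gap -[k.+2%:R]natr1 [t ^+ k.+2]exprS; ring.
rewrite ger0_norm ?pow_gap_ge0 ?(andP s01).1 ?(andP t01).1//.
apply: le_trans (pow_gap_le k s01 t01) _.
rewrite expr1n mulr1 -/K -real_normK ?num_real// expr2 mulrA ler_wpM2r//.
rewrite ltr_pdivlMr// in st; apply: le_trans (ltW st).
by rewrite mulrC ler_wpM2l// lerDl.
Qed.

(** The mean value theorem asks for a two-sided derivative in the interior only and for continuity
    on the closed interval; relative differentiability provides both. *)
Lemma slope01_nondecreasing e e1 : slope01 e e1 ->
  (forall t, 0 <= t <= 1 -> 0 <= e1 t) -> forall t, 0 <= t <= 1 -> e 0 <= e t.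
Proof.
move=> h h1 t /andP[t0 t1].
have [s||c] := @MVT_segment R e e1 0 t t0.
- rewrite in_itv /= => /andP[s0 st]; have s1 : s < 1 by exact: lt_le_trans st t1.
  apply: is_derive_from_slope => eps eps0.
  have [|r r0 hr] := h s _ _ eps0; first by rewrite !ltW.
  (* The radius is cut so that the neighbourhood of [s] stays inside [0, 1]. *)
  exists (Num.min r (Num.min s (1 - s))).
    by rewrite !lt_min r0 s0 subr_gt0.
  move=> q; rewrite !lt_min => /and3P[qr qs q1]; apply: hr => //.
  by move: qs q1; rewrite !ltr_norml => /andP[? ?] /andP[? ?]; apply/andP; split; lra.
- apply/subspace_continuousP => s /=; rewrite in_itv /= => /andP[s0 st].
  have s1 : s <= 1 by exact: le_trans st t1.
  have [|r r0 hr] := h s _ _ (@ltr01 R); first by rewrite s0.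
  apply/cvgrPdist_le => d d0; rewrite near_withinE.
  have K0 : 0 < `|e1 s| + 1 by rewrite ltr_wpDl.
  near=> q; rewrite /= in_itv /= => /andP[q0 qt].
  have qs : `|q - s| < Num.min r (d / (`|e1 s| + 1)).
    rewrite distrC; near: q; apply: (@cvgr_dist_lt R R R (nbhs s) _ idfun s) => //.
    by rewrite lt_min r0 divr_gt0.
  move: qs; rewrite lt_min ltr_pdivlMr// => /andP[qr qd].
  have /hr/(_ qr) : 0 <= q <= 1 by rewrite q0 (le_trans qt).
  rewrite mul1r => hq; rewrite distrC; apply: le_trans (ltW qd).
  rewrite -[e q - e s](subrK (e1 s * (q - s))).
  apply: le_trans (ler_normD _ _) _; rewrite [X in _ <= X]mulrDr [X in _ <= X]addrC mulr1.
  by rewrite lerD// normrM mulrC.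
- rewrite in_itv /= subr0 => /andP[c0 ct] /eqP; rewrite subr_eq => /eqP->.
  by rewrite lerDr mulr_ge0// h1// c0 (le_trans ct).
Unshelve. all: by end_near. Qed.

Lemma slope01_le e e1 g g1 : slope01 e e1 -> slope01 g g1 ->
  e 0 = 0 -> g 0 = 0 -> (forall t, 0 <= t <= 1 -> `|e1 t| <= g1 t) ->
  forall t, 0 <= t <= 1 -> `|e t| <= g t.
Proof.
move=> he hg e0 g0 eg t t01; rewrite ler_norml; apply/andP; split.
  have := slope01_nondecreasing (slope01D hg he) _ t01; rewrite e0 g0 addr0.
  rewrite -lerBlDl sub0r; apply => s /eg; rewrite ler_norml => /andP[]; lra.
have := slope01_nondecreasing (slope01D hg (slope01Z (-1) he)) _ t01.
rewrite e0 g0 mulr0 addr0 mulN1r subr_ge0; apply => s /eg.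
rewrite ler_norml => /andP[]; lra.
Qed.

(** The derivative of the remainder of order [p.+1] is the remainder of order [p] of the shifted
    family. Hence [slope01_le] integrates the bound once per induction step, without any
    integral. *)
Lemma slope01_taylor p (phi : nat -> R -> R) M :
  (forall i, (i < p)%N -> slope01 (phi i) (phi i.+1)) ->
  (forall t, 0 <= t <= 1 -> `|phi p t - phi p 0| <= M * t) ->
  forall t, 0 <= t <= 1 ->
    `|phi 0%N t - \sum_(j < p.+1) phi j 0 * (t ^+ j / j`!%:R)|
      <= M * (t ^+ p.+1 / p.+1`!%:R).
Proof.
elim: p phi => [|p ih] phi sl lip.
  move=> t t01; rewrite big_ord_recl big_ord0 addr0 expr0 divr1 mulr1 expr1 divr1.
  exact: lip.
have := ih (fun i => phi i.+1) (fun i => sl i.+1) lip.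
apply: slope01_le.
- rewrite (_ : (fun t => _ - _) = fun t => phi 0%N t
     + (-1) * (phi 0%N 0 + \sum_(j < p.+1) phi j.+1 0 * (t ^+ j.+1 / j.+1`!%:R))).
    rewrite (_ : (fun t => _ - _) = fun t => phi 1%N t
       + (-1) * (0 + \sum_(j < p.+1) phi j.+1 0 * (t ^+ j / j`!%:R))).
      apply: slope01D; first exact: sl.
      apply/slope01Z/slope01D; first exact: slope01_cst.
      by apply: slope01_sum => i; apply: slope01Z; exact: slope01_monomial.
    by apply/funext => t; rewrite add0r mulN1r.
  apply/funext => t; rewrite big_ord_recl expr0 divr1 mulr1 mulN1r.
  by congr (_ - (_ + _)); apply: eq_bigr.
- by apply: slope01Z; exact: slope01_monomial.
- rewrite big_ord_recl expr0 divr1 mulr1 big1 ?addr0 ?subrr// => i _.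
  by rewrite exprS mul0r mul0r mulr0.
- by rewrite exprS !mul0r mulr0.
Qed.

(** * Taylor bound along segments of the domain *)

Section TaylorBound.
Context {E : vectType R} (B : 'Hom(E, 'Hom(E, R^o))).
Hypothesis spB : sym_posdef B.
Local Notation nrm := (Bnorm B).
Variables (D : set E) (p : nat) (f : E -> R) (Df : E -> seq E -> R) (L : R).
Hypotheses (dD : derivatives_on B D p f Df)
  (lD : lipschitz_derivative B D p Df L).
Hypothesis convD : forall x y (t : R), D x -> D y -> 0 <= t <= 1 ->
  D (x + t *: (y - x)).

Lemma derivatives_on_homog x a u s1 s2 : D x -> (size s1 + size s2 < p)%N ->
  Df x (s1 ++ (a *: u) :: s2) = a * Df x (s1 ++ u :: s2).
Proof.
move=> /dD[_ lin _ _] sz.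
have z : Df x (s1 ++ 0 :: s2) = 0.
  have := lin s1 s2 1 0 0 sz; rewrite scaler0 addr0 mul1r => /eqP.
  by rewrite -subr_eq subrr => /eqP.
by have := lin s1 s2 a u 0 sz; rewrite addr0 z addr0.
Qed.

(** The prefix of [j] unscaled copies is an accumulator: each induction step frees one entry of its
    scalar and moves it there. *)
Lemma derivatives_on_nseqZ x a u k j : D x -> (k + j <= p)%N ->
  Df x (nseq j u ++ nseq k (a *: u)) = a ^+ k * Df x (nseq (k + j) u).
Proof.
move=> Dx; elim: k j => [|k ih] j kj; first by rewrite cats0 expr0 mul1r.
rewrite derivatives_on_homog//; last by rewrite !size_nseq addnC.
rewrite -cat_rcons.
have -> : rcons (nseq j u) u = nseq j.+1 u.
  by rewrite -cats1 -[[:: u]]/(nseq 1 u) -nseqD addn1.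
by rewrite ih ?addnS// exprS mulrA.
Qed.

Lemma lipschitz_derivative_diag x y u : D x -> D y ->
  `|Df y (nseq p u) - Df x (nseq p u)| <= L * nrm (y - x) * nrm u ^+ p.
Proof.
move=> Dx Dy.
have key w : nrm w <= 1 ->
    `|Df y (nseq p w) - Df x (nseq p w)| <= L * nrm (y - x).
  move=> w1.
  (* [form_norm] is a supremum of signed values, so the absolute value is recovered by exchanging
     the two points. *)
  have bnd x1 x2 : D x1 -> D x2 ->
      Df x1 (nseq p w) - Df x2 (nseq p w) <= L * nrm (x1 - x2).
    move=> D1 D2; rewrite -lee_fin; apply: le_trans (lD D1 D2).
    apply: ereal_sup_ubound; exists (nseq p w) => //=; split.
      by rewrite size_nseq.
    by move=> h /nseqP[->].
  rewrite ler_norml bnd// andbT lerNl opprB; apply: le_trans (bnd _ _ Dx Dy) _.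
  by rewrite BnormB.
pose w := (nrm u)^-1 *: u.
have uw : u = nrm u *: w.
  have [->|u0] := eqVneq u 0; first by rewrite Bnorm0 scale0r.
  by rewrite scalerA mulfV ?scale1r// gt_eqF// Bnorm_gt0.
have w1 : nrm w <= 1.
  rewrite Bnorm_homog ger0_norm ?invr_ge0 ?Bnorm_ge0//.
  have [->|u0] := eqVneq u 0; first by rewrite Bnorm0 mulr0.
  by rewrite mulVf// gt_eqF// Bnorm_gt0.
have hom z : D z -> Df z (nseq p u) = nrm u ^+ p * Df z (nseq p w).
  by move=> Dz; have := @derivatives_on_nseqZ z (nrm u) w p 0 Dz; rewrite addn0 -uw; apply.
rewrite !hom// -mulrBr normrM ger0_norm ?exprn_ge0 ?Bnorm_ge0// mulrC.
by rewrite ler_wpM2r ?exprn_ge0 ?Bnorm_ge0// key.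
Qed.

Lemma slope01_derivative x u i : D x -> D (x + u) -> (i < p)%N ->
  slope01 (fun t => Df (x + t *: u) (nseq i u))
          (fun t => Df (x + t *: u) (nseq i.+1 u)).
Proof.
move=> Dx Dxu ip t t01 eps eps0.
have Dt s : 0 <= s <= 1 -> D (x + s *: u).
  by move=> s01; have := convD Dx Dxu s01; rewrite [x + u]addrC addrK.
have u1 : 0 < nrm u + 1 by rewrite ltr_wpDl ?Bnorm_ge0.
have [_ _ _ dt] := dD (Dt _ t01).
have szi : (size (nseq i u) < p)%N by rewrite size_nseq.
have [r r0 hr] := dt _ szi _ (divr_gt0 eps0 u1).
exists (r / (nrm u + 1)) => [|s s01 st]; first by rewrite divr_gt0.
have e : x + s *: u - (x + t *: u) = (s - t) *: u.
  by rewrite opprD addrACA subrr add0r scalerBl.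
have := hr _ (Dt _ s01); rewrite e Bnorm_homog.
have -> : Df (x + t *: u) ((s - t) *: u :: nseq i u)
    = (s - t) * Df (x + t *: u) (nseq i.+1 u).
  by have := @derivatives_on_homog _ (s - t) u [::] (nseq i u) (Dt _ t01); apply.
rewrite [_ * Df _ _]mulrC => h; apply: le_trans (h _) _.
  move: st; rewrite ltr_pdivlMr//; apply: le_lt_trans.
  by rewrite ler_wpM2l// lerDl.
rewrite [`|_| * _]mulrC mulrA ler_wpM2r// mulrAC ler_pdivrMr//.
by rewrite ler_wpM2l ?(ltW eps0)// lerDl.
Qed.

(** This is [slope01_taylor] at [t = 1] for the functions sending [t] to the [i]th form at
    [x + t *: u] on [i] copies of [u = y - x]. *)
Lemma taylor_lipschitz x y : D x -> D y ->
  `|f y - (f x + \sum_(1 <= i < p.+1) Df x (nseq i (y - x)) / i`!%:R)|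
    <= L * nrm (y - x) ^+ p.+1 / p.+1`!%:R.
Proof.
move=> Dx Dy; set u := y - x; have yE : y = x + u by rewrite addrC subrK.
have Dt s : 0 <= s <= 1 -> D (x + s *: u) by move=> s01; exact: convD.
have Dxu : D (x + u) by rewrite -yE.
have lip t : 0 <= t <= 1 ->
    `|Df (x + t *: u) (nseq p u) - Df (x + 0 *: u) (nseq p u)|
      <= L * nrm u ^+ p.+1 * t.
  move=> t01; rewrite scale0r addr0.
  apply: le_trans (lipschitz_derivative_diag _ Dx (Dt _ t01)) _.
  rewrite [x + _]addrC addrK Bnorm_homog ger0_norm ?(andP t01).1//.
  by rewrite le_eqVlt exprS; apply/orP; left; apply/eqP; ring.
have := slope01_taylor (fun i => @slope01_derivative x u i Dx Dxu) lip.
move=> /(_ 1); rewrite ler01 lexx => /(_ isT).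
rewrite scale1r scale0r addr0 -yE expr1n mul1r.
congr (`|_ - _| <= _).
  by have [] := dD Dy.
rewrite big_add1 /= big_mkord big_ord_recl /= expr0 divr1 mulr1.
have [-> _ _ _] := dD Dx; congr (_ + _); apply: eq_bigr => i _.
by rewrite expr1n mul1r.
Qed.

End TaylorBound.
End Taylor.

(** * Inexact minimization of prox-regularized functions *)

Section ExtendedObjective.
Context {R : realType} {E : vectType R}.
Variables (D : set E) (h : E -> \bar R) (hr : E -> R) (m : R) (y0 : E).
Hypotheses (Dy0 : D y0) (hD : forall y, D y -> h y = (hr y)%:E)
  (hND : forall y, ~ D y -> h y = +oo%E) (mD : forall y, D y -> m <= hr y).

Let has_inf_hr : has_inf (hr @` D).
Proof.
split; first by exists (hr y0), y0.
by exists m => _ [y Dy <-]; exact: mD.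
Qed.

Lemma inf_image_le y : D y -> inf (hr @` D) <= hr y.
Proof. by move=> Dy; apply: ge_inf; [case: has_inf_hr|exists y]. Qed.

Lemma inf_image_adherent eps : 0 < eps ->
  exists2 y, D y & hr y < inf (hr @` D) + eps.
Proof.
by move=> e0; have [_ [y Dy <-] ?] := inf_adherent e0 has_inf_hr; exists y.
Qed.

Lemma min_value_fin : min_value h = (inf (hr @` D))%:E.
Proof.
apply/eqP; rewrite eq_le; apply/andP; split.
  apply/lee_addgt0Pr => e e0; have [y Dy hy] := inf_image_adherent e0.
  apply: (@le_trans _ _ (h y)); first by apply: ereal_inf_lbound; exists y.
  by rewrite hD// -EFinD lee_fin ltW.
apply: le_ereal_inf_tmp => _ [y _ <-]; have [Dy|nDy] := pselect (D y).
  by rewrite hD// lee_fin inf_image_le.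
by rewrite hND// leey.
Qed.

(** Bridge from extended to real values: the infimum is a real number, while outside [D] the excess
    is infinite. Later estimates are made on the real side. *)
Lemma subopt_fin e x :
  subopt h e%:E x <-> D x /\ hr x <= inf (hr @` D) + e.
Proof.
rewrite /subopt min_value_fin; have [Dx|nDx] := pselect (D x).
  by rewrite hD// -EFinB lee_fin lerBlDl; split=> [|[]].
by rewrite hND//=; split=> [|[]].
Qed.

End ExtendedObjective.

(** * Convex functions plus a Bregman term *)

Section ProxConvex.
Context {R : realType} {E : vectType R} (B : 'Hom(E, 'Hom(E, R^o))).
Hypothesis spB : sym_posdef B.
Local Notation nrm := (Bnorm B).
Variables (m : nat) (x0 v : E) (D : set E) (G : E -> R).
Local Notation breg := (prox_breg B m x0).
Hypothesis convD : forall x y (t : R), D x -> D y -> 0 <= t <= 1 ->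
  D (x + t *: (y - x)).
Hypothesis convG : forall x y (t : R), D x -> D y -> 0 <= t <= 1 ->
  G (x + t *: (y - x)) <= (1 - t) * G x + t * G y.

Definition prox_obj y : R := G y + breg v y.

Lemma prox_gradDr w u1 u2 :
  prox_grad B m x0 w (u1 + u2) = prox_grad B m x0 w u1 + prox_grad B m x0 w u2.
Proof. by rewrite /prox_grad BformDr mulrDr. Qed.

Lemma prox_gradZr w t u : prox_grad B m x0 w (t *: u) = t * prox_grad B m x0 w u.
Proof. by rewrite /prox_grad BformZr mulrCA. Qed.

(** [breg v] differs from [d] by an affine function, so its convexity defect on a segment is that of
    [d], which the divergences from [w] express exactly. *)
Lemma prox_obj_convex x y (t : R) (w := x + t *: (y - x)) :
  D x -> D y -> 0 <= t <= 1 ->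
  prox_obj w <= (1 - t) * prox_obj x + t * prox_obj y
    - ((1 - t) * breg w x + t * breg w y).
Proof.
move=> Dx Dy t01; rewrite /prox_obj; have := convG Dx Dy t01; rewrite -/w.
suff -> : breg v w = (1 - t) * breg v x + t * breg v y
   - ((1 - t) * breg w x + t * breg w y) by move=> ?; lra.
have ew : w - v = (x - v) + t *: (y - x) by rewrite /w addrAC.
have ey : y - v = (x - v) + (y - x) by rewrite [RHS]addrC addrA subrK.
have ex' : x - w = (- t) *: (y - x) by rewrite /w opprD addrA subrr sub0r scaleNr.
have ey' : y - w = (1 - t) *: (y - x).
  by rewrite /w scalerBl scale1r opprD addrA.
rewrite /prox_breg ew ey ex' ey'; clear; clearbody w.
by move: (x - v) (y - x) => q u; rewrite !prox_gradDr !prox_gradZr; ring.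
Qed.

Lemma prox_obj_inexact_min v' y e (t : R) :
  D v' -> D y -> (forall z, D z -> prox_obj v' <= prox_obj z + e) ->
  0 < t <= 1 ->
  prox_obj v' + breg v' y <= prox_obj y
    + (e / t + t * (m.+1%:R / 2 * (nrm (y - v') + nrm (y - x0)) ^+ m.+2)).
Proof.
move=> Dv' Dy minv' /andP[t0 t1]; have t01 : 0 <= t <= 1 by rewrite ltW.
set w := v' + t *: (y - v'); have Dw : D w by exact: convD.
(* [M] dominates the distances of [v'] and [w] from [x0] and that of [y] from [v'], so [breg v' w]
   is at most [t ^+ 2] times a multiple of one power of [M]. *)
set M := nrm (y - v') + nrm (y - x0).
have M0 : 0 <= M by rewrite addr_ge0 ?Bnorm_ge0.
have vM : nrm (v' - x0) <= M.
  rewrite /M (BnormB _ y v') (_ : v' - x0 = (v' - y) + (y - x0)) ?Bnorm_triangle//.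
  by rewrite addrA subrK.
have ew : w - v' = t *: (y - v') by rewrite /w addrAC subrr add0r.
have wM : nrm (w - x0) <= M.
  have -> : w - x0 = (1 - t) *: (v' - x0) + t *: (y - x0).
    rewrite /w (_ : y - v' = (y - x0) - (v' - x0)); last first.
      by rewrite opprB addrA subrK.
    by rewrite scalerBl scale1r scalerBr addrAC addrA addrAC.
  apply: le_trans (Bnorm_triangle spB _ _) _.
  rewrite !Bnorm_homog !ger0_norm ?subr_ge0 ?(ltW t0)//.
  have : nrm (y - x0) <= M by rewrite lerDr Bnorm_ge0.
  move: vM; move: (nrm (v' - x0)) (nrm (y - x0)) => a b aM bM.
  have := ler_wpM2l (ltW t0) bM; have t1' : 0 <= 1 - t by rewrite subr_ge0.
  by have := ler_wpM2l t1' aM; lra.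
have bw : breg v' w <= t ^+ 2 * (m.+1%:R / 2 * M ^+ m.+2).
  apply: le_trans (prox_breg_le spB m wM vM) _; rewrite ew Bnorm_homog exprMn.
  rewrite real_normK ?num_real// mulrCA ler_wpM2l ?sqr_ge0//.
  have -> : m.+1%:R / 2 * M ^+ m.+2 = m.+1%:R / 2 * M ^+ m * M ^+ 2.
    by rewrite -[m.+2]addn2 exprD mulrA.
  rewrite ler_wpM2l//; first by rewrite mulr_ge0 ?exprn_ge0// divr_ge0 ?ler0n.
  by rewrite lerXn2r ?nnegrE ?Bnorm_ge0// lerDl Bnorm_ge0.
have h1 := minv' _ Dw; have h2 := convG Dv' Dy t01.
(* Three-point identity on the segment; its term [t * breg v' y], divided by [t], is the gain in the
   conclusion. *)
have three : breg v w = (1 - t) * breg v v' + t * breg v y - t * breg v' y + breg v' w.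
  have ex : y - v = (v' - v) + (y - v') by rewrite [RHS]addrC addrA subrK.
  have ez : w - v = (v' - v) + t *: (y - v') by rewrite /w addrAC.
  rewrite /prox_breg ew ex ez; clear; clearbody w.
  by move: (v' - v) (y - v') => q u; rewrite !prox_gradDr !prox_gradZr; ring.
rewrite -(ler_pM2l t0) (_ : t * (_ + (e / t + _)) = t * prox_obj y + e
  + t ^+ 2 * (m.+1%:R / 2 * M ^+ m.+2)); last by field; rewrite gt_eqF.
move: h1 h2 bw; rewrite /prox_obj -/w three.
move: (t ^+ 2 * _) => Y; lra.
Qed.

End ProxConvex.

(** * Progress possible in one tensor step *)

Section TensorProgress.
Context {R : realType} {E : vectType R} (B : 'Hom(E, 'Hom(E, R^o))).
Hypothesis spB : sym_posdef B.
Local Notation nrm := (Bnorm B).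
Variables (m : nat) (x0 v : E) (D : set E) (G : E -> R).
Hypothesis convD : forall x y (t : R), D x -> D y -> 0 <= t <= 1 ->
  D (x + t *: (y - x)).
Hypothesis convG : forall x y (t : R), D x -> D y -> 0 <= t <= 1 ->
  G (x + t *: (y - x)) <= (1 - t) * G x + t * G y.
Local Notation hr := (prox_obj B m x0 v G).
Variables (hs K : R) (Om : E -> E -> R).
Hypothesis hs_le : forall y, D y -> hs <= hr y.
Hypothesis hs_adherent : forall eps, 0 < eps -> exists2 y, D y & hr y < hs + eps.
Hypothesis Om_le : forall z y, D z -> D y ->
  Om z y <= hr y + K * nrm (y - z) ^+ m.+2.

(** The constant of [prox_breg_ge], with a factor [2 ^- m.+2] because the midpoint is at half the
    distance from either end. *)
Definition unif_cvx : R := 4 ^- m.+1 / m.+2%:R / 2 ^+ m.+2.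

Lemma unif_cvx_gt0 : 0 < unif_cvx.
Proof.
by rewrite /unif_cvx !mulr_gt0 ?invr_gt0 ?exprn_gt0 ?ltr0n.
Qed.

Lemma prox_obj_midpoint z y : D z -> D y ->
  unif_cvx * nrm (y - z) ^+ m.+2 <= (hr z + hr y) / 2 - hs.
Proof.
move=> Dz Dy; have t01 : 0 <= (2^-1 : R) <= 1 by apply/andP; split; lra.
have := @prox_obj_convex _ _ B m x0 v D G convG z y _ Dz Dy t01; set w := z + _.
have := hs_le (convD Dz Dy t01); rewrite -/w.
have e1 : z - w = - (2^-1 *: (y - z)) by rewrite /w opprD addrA subrr sub0r.
have e2 : y - w = 2^-1 *: (y - z).
  rewrite /w opprD addrA -[X in X - _ = _]scale1r -scalerBl; congr (_ *: _); lra.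
have := prox_breg_ge spB m x0 w z; have := prox_breg_ge spB m x0 w y.
rewrite e1 e2 BnormN Bnorm_homog ger0_norm ?(andP t01).1// exprMn.
have -> : 4 ^- m.+1 / m.+2%:R * (2^-1 ^+ m.+2 * nrm (y - z) ^+ m.+2)
   = unif_cvx * nrm (y - z) ^+ m.+2 by rewrite /unif_cvx exprVn; ring.
move: (unif_cvx * _) (prox_breg _ _ _ _ z) (prox_breg _ _ _ _ y) => *; lra.
Qed.

(** A move by the fraction [a] towards a near-minimizer [y] gains linearly in [a], while the model
    error is of order [a ^+ 2 * nrm (y - z) ^+ m.+2], a power of the distance that
    [prox_obj_midpoint] bounds by the residual. *)
Lemma tensor_progress a z : D z -> 0 <= K -> 0 < a <= 1 ->
  4 * K * a <= unif_cvx -> hs < hr z ->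
  exists2 w, D w & Om z w <= hs + (1 - a / 2) * (hr z - hs).
Proof.
move=> Dz K0 /andP[a0 a1] Ka hz; set r := hr z - hs.
have r0 : 0 < r by rewrite subr_gt0.
(* The suboptimality of [y] costs at most [a * r / 4] and so does the model error, which leaves half
   of the gain [a * r]. *)
have [y Dy hy] := hs_adherent (divr_gt0 r0 (@ltr0n _ 4)).
have a01 : 0 <= a <= 1 by rewrite ltW.
exists (z + a *: (y - z)); first exact: convD.
set w := z + _; apply: le_trans (Om_le Dz (convD Dz Dy a01)) _; rewrite -/w.
have -> : w - z = a *: (y - z) by rewrite /w addrAC subrr add0r.
rewrite Bnorm_homog ger0_norm ?(ltW a0)// exprMn.
have mid := prox_obj_midpoint Dz Dy.
have hw := @prox_obj_convex _ _ B m x0 v D G convG z y _ Dz Dy a01; rewrite -/w in hw.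
have N0 : 0 <= nrm (y - z) ^+ m.+2 by rewrite exprn_ge0 ?Bnorm_ge0.
have N1 : unif_cvx * nrm (y - z) ^+ m.+2 <= r.
  by apply: le_trans mid _; move: hy; rewrite /r; lra.
have h1 : a ^+ m.+2 * nrm (y - z) ^+ m.+2 <= a * a * nrm (y - z) ^+ m.+2.
  rewrite ler_wpM2r// !exprS mulrA ler_piMr ?mulr_ge0 ?(ltW a0)//.
  by rewrite exprn_ile1// ltW.
have h2 := ler_wpM2l K0 h1; have h3 := ler_wpM2r N0 Ka.
have h4 := ler_wpM2l (ltW a0) (le_trans h3 N1).
have b1 := prox_breg_ge0 spB m x0 w z; have b2 := prox_breg_ge0 spB m x0 w y.
have a1' : 0 <= 1 - a by rewrite subr_ge0.
have b3 := mulr_ge0 a1' b1; have b4 := mulr_ge0 (ltW a0) b2.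
have h5 := ler_wpM2l (ltW a0) (ltW hy).
apply: le_trans (lerD hw h2) _.
move: h4 b3 b4 h5; rewrite (_ : a * (4 * K * a * nrm (y - z) ^+ m.+2)
  = 4 * (K * (a * a * nrm (y - z) ^+ m.+2))); last by ring.
have -> : hr z = hs + r by rewrite /r addrC subrK.
move: (K * _) ((1 - a) * prox_breg _ _ _ _ _) (a * prox_breg _ _ _ _ _) => X Y Z.
clearbody r; move=> *; lra.
Qed.

End TensorProgress.

(** * Scalar recursions *)

Section StepCount.
Context {R : realType}.

Lemma inexact_descent_count (n : nat) (r : nat -> R) (zeta T q c' : R) :
  0 < zeta -> zeta <= 2 * T -> 0 < q <= 1 -> 0 <= c' <= q / 4 ->
  (forall j, (j < n)%N -> zeta < r j) ->
  (forall j, (j < n)%N -> r j.+1 <= r j) ->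
  ((0 < n)%N -> r 1%N <= T) ->
  (forall j, (j.+1 < n)%N ->
     r j.+2 <= (1 - q) * r j.+1 + c' * (r j - r j.+1)) ->
  n%:R <= 3 + 2 / q * ln (2 * T / zeta).
Proof.
move=> z0 zT /andP[q0 q1] /andP[c0 cq] rz rmon r1 rrec.
have ln0 : 0 <= ln (2 * T / zeta) by rewrite ln_ge0// ler_pdivlMr// mul1r.
have q2 : 0 <= 2 / q by rewrite divr_ge0// ltW.
(* The constant 3 covers runs of at most two steps and the shift of index by three afterwards. *)
case: n rz rmon r1 rrec => [|[|[|n]]] rz rmon r1 rrec;
  try by (have := mulr_ge0 q2 ln0; lra).
have T0 : 0 < 2 * T by exact: lt_le_trans zT.
(* The accuracy of a step involves the preceding residual. Adding [q / 2] times that residual turns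
   the second-order recursion into a contraction by [1 - q / 2]: the coefficient [c' <= q / 4] is at
   most [(1 - q / 2) * (q / 2)] since [q <= 1]. *)
pose s j := r j.+2 + q / 2 * r j.+1.
have sn i : (i <= n)%N -> s i <= (1 - q / 2) ^+ i * (2 * T).
  elim: i => [|i ih] iN.
    rewrite expr0 mul1r /s; have h1 := r1 isT; have h2 := rmon 1%N isT.
    have p1 : zeta < r 1%N by apply: rz.
    have : q / 2 * r 1%N <= 1 * r 1%N by rewrite ler_wpM2r//; lra.
    lra.
  have h := ih (ltnW iN); rewrite exprS -mulrA.
  have l0 : 0 <= 1 - q / 2 by lra.
  apply: le_trans (ler_wpM2l l0 h); rewrite /s.
  have h1 := rrec i.+1 (leqW iN).
  have p1 : zeta < r i.+1 by apply: rz; rewrite ltnS leqW// ltnW.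
  have p2 : zeta < r i.+2 by apply: rz; rewrite !ltnS ltnW.
  have k1 : c' * r i.+1 <= q / 4 * r i.+1 by rewrite ler_wpM2r//; lra.
  have k2 : 0 <= c' * r i.+2 by rewrite mulr_ge0//; lra.
  have k3 : q * q * r i.+1 <= q * r i.+1.
    by rewrite ler_wpM2r ?ler_piMr//; lra.
  lra.
have h1 : zeta < r n.+2 by apply: rz.
have h2 : zeta < (1 - q / 2) ^+ n * (2 * T).
  apply: lt_le_trans (sn _ (leqnn n)); rewrite /s ltr_wpDr//.
  by rewrite mulr_ge0//; [lra|apply/ltW/(lt_trans z0)/rz].
have h3 : zeta < expR (- (q / 2)) ^+ n * (2 * T).
  apply: lt_le_trans h2 _; rewrite ler_wpM2r ?(ltW T0)// lerXn2r ?nnegrE ?expR_ge0//.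
    lra.
  exact: expR_ge1Dx.
have h4 : ln zeta < - (q / 2) *+ n + ln (2 * T).
  rewrite -ltr_expR lnK ?posrE// expRD lnK ?posrE//.
  by rewrite -expRM_natl mulr_natl in h3 *.
rewrite ln_div ?posrE//.
have h5 : q / 2 * n%:R <= ln (2 * T) - ln zeta.
  by move: h4; rewrite mulNrn -mulr_natr; lra.
have : n%:R <= 2 / q * (ln (2 * T) - ln zeta).
  by rewrite mulrC -ler_pdivrMr ?divr_gt0// invf_div mulrC.
by rewrite -[n.+3]addn3 natrD; lra.
Qed.

(** From [1 + u <= expR u], the product of the growth factors is at most the exponential of a
    telescoping sum. *)
Lemma expR_product_bound (W s : nat -> R) (k : nat) :
  0 <= W 0%N -> (forall j, 0 <= s j) ->
  (forall j, (j < k)%N -> W j.+1 <= (1 + (s j - s j.+1)) * W j) ->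
  (forall j, (j <= k)%N -> 0 <= W j) ->
  W k <= expR (s 0%N) * W 0%N.
Proof.
move=> W0 s0 Wrec Wge0.
suff : W k <= expR (s 0%N - s k) * W 0%N.
  move=> /le_trans; apply; rewrite ler_wpM2r// ler_expR.
  by rewrite lerBlDr lerDl.
elim: k Wrec Wge0 => [|k ih] Wrec Wge0; first by rewrite subrr expR0 mul1r.
apply: le_trans (Wrec _ (ltnSn k)) _.
have -> : s 0%N - s k.+1 = (s k - s k.+1) + (s 0%N - s k) by ring.
rewrite expRD -mulrA; apply: (@le_trans _ _ (expR (s k - s k.+1) * W k)).
  by rewrite ler_wpM2r ?expR_ge1Dx// Wge0.
rewrite ler_wpM2l ?expR_ge0// ih// => j jk; first by rewrite Wrec// ltnW.
by rewrite Wge0// ltnW.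
Qed.

(* Weights for the inexactness of the outer steps: they telescope, hence are
   summable, and decay only like [k ^ (- 3/2)], as their square must dominate
   the accuracies [k ^ (- p - 2)]. *)
Definition slack (k : nat) : R := (Num.sqrt k.+1%:R)^-1.

Lemma slack_ge0 k : 0 <= slack k.
Proof. by rewrite invr_ge0 sqrtr_ge0. Qed.

(** With [u] and [w] the roots of [k.+1] and [k.+2], rationalizing gives
    [eta = 1 / ((w + u) * u * w)]. As [w ^+ 2 = u ^+ 2 + 1 <= 2 * u ^+ 2], its inverse square is at
    most [12 * u ^+ 6]. *)
Lemma slack_diff k (eta := slack k - slack k.+1) :
  [/\ 0 < eta, eta <= 1 & (k.+1%:R ^+ 3)^-1 <= 32 * eta ^+ 2].
Proof.
rewrite /eta /slack; set u := Num.sqrt _; set w := Num.sqrt _.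
have u2 : u ^+ 2 = k.+1%:R by rewrite sqr_sqrtr.
have w2 : w ^+ 2 = u ^+ 2 + 1 by rewrite u2 natr1 sqr_sqrtr.
have u1 : 1 <= u by rewrite -sqrtr1 ler_sqrt// ler1n.
have u0 : 0 < u by apply: lt_le_trans u1.
have w0 : 0 < w by rewrite sqrtr_gt0 ltr0n.
have uw : u < w by rewrite ltr_sqrt ?ltr0n// ltr_nat.
have e : u^-1 - w^-1 = (w - u) / (u * w) by field; rewrite !gt_eqF.
have wu : w - u = (w + u)^-1.
  apply: (@mulIf _ (w + u)); first by rewrite gt_eqF// addr_gt0.
  by rewrite mulVf ?gt_eqF ?addr_gt0//; move: w2; rewrite !expr2; lra.
split.
- by rewrite e divr_gt0 ?mulr_gt0// subr_gt0.
- apply: (@le_trans _ _ u^-1); first by rewrite lerBlDr lerDl invr_ge0 ltW.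
  by rewrite invf_le1.
have -> : (u^-1 - w^-1) ^+ 2 = ((w + u) ^+ 2 * u ^+ 2 * w ^+ 2)^-1.
  by rewrite e wu; field; rewrite !gt_eqF ?addr_gt0.
have v1 : 1 <= u ^+ 2 by rewrite u2 ler1n.
have wu0 : 0 < w + u by rewrite addr_gt0.
rewrite -u2 ler_pdivlMr ?mulr_gt0 ?exprn_gt0// mulrC ler_pdivrMr ?exprn_gt0//.
have h : (w + u) ^+ 2 <= 6 * u ^+ 2.
  by have := sqr_ge0 (w - u); move: w2 v1; rewrite !expr2; lra.
rewrite -exprM (_ : 32 * u ^+ (2 * 3) = (32 * (u ^+ 2) ^+ 2) * u ^+ 2); last by ring.
rewrite mulrAC ler_wpM2r ?sqr_ge0//.
apply: (@le_trans _ _ (6 * u ^+ 2 * (2 * u ^+ 2))).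
  by apply: ler_pM; rewrite ?sqr_ge0//; move: w2 v1; lra.
by move: (u ^+ 2) v1 => x x1; have := sqr_ge0 x; rewrite expr2; lra.
Qed.

End StepCount.

(** * Constants depending only on the degree *)

Section BregmanConstant.
Context {R : realType}.

(** Product of the factor in the error of [prox_obj_inexact_min], the factor of [exprD_le] and the
    inverse of the uniform convexity constant of [d]. *)
Definition bregman_cst (m : nat) : R :=
  m.+1%:R / 2 * 2 ^+ m.+2 * (4 ^+ m.+1 * m.+2%:R).

Lemma bregman_cst_ge1 m : 1 <= bregman_cst m.
Proof.
have h : 1 <= (4 ^+ m.+1 * m.+2%:R : R).
  by rewrite mulr_ege1 ?exprn_ege1 ?ler1n.
have -> : bregman_cst m = m.+1%:R * 2 ^+ m.+1 * (4 ^+ m.+1 * m.+2%:R).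
  by rewrite /bregman_cst [2 ^+ m.+2]exprS; field.
by rewrite mulr_ege1// mulr_ege1 ?exprn_ege1 ?ler1n.
Qed.

Lemma bregman_dist (E : vectType R) (B : 'Hom(E, 'Hom(E, R^o))) m (x0 y z : E) :
  sym_posdef B ->
  Bnorm B (y - z) ^+ m.+2 <= 4 ^+ m.+1 * m.+2%:R * prox_breg B m x0 z y.
Proof.
move=> spB; have s0 : 0 < (4 ^+ m.+1 * m.+2%:R : R).
  by rewrite mulr_gt0 ?exprn_gt0 ?ltr0n.
rewrite -ler_pdivrMl// invfM; exact: prox_breg_ge.
Qed.

Lemma bregman_cst_le (E : vectType R) (B : 'Hom(E, 'Hom(E, R^o))) m (x0 y xs : E)
    (D0 N : R) : sym_posdef B -> 0 <= N -> N ^+ m.+2 <= D0 ->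
  m.+1%:R / 2 * (Bnorm B (xs - y) + N) ^+ m.+2
    <= bregman_cst m * (prox_breg B m x0 y xs + D0).
Proof.
move=> spB N0 ND; set T := _ + D0.
rewrite (_ : _ * T = m.+1%:R / 2 * (2 ^+ m.+2 * (4 ^+ m.+1 * m.+2%:R * T))).
  rewrite ler_wpM2l ?divr_ge0 ?ler0n//.
  apply: le_trans (exprD_le m.+2 (Bnorm_ge0 B (xs - y)) N0) _.
  rewrite ler_wpM2l ?exprn_ge0//.
  have D00 : 0 <= D0 by apply: le_trans ND; rewrite exprn_ge0.
  rewrite /T mulrDr lerD ?bregman_dist//.
  apply: le_trans ND _; rewrite ler_peMl//.
  by rewrite mulr_ege1 ?exprn_ege1 ?ler1n.
by rewrite /bregman_cst; ring.
Qed.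

(** The error is proportional to the new quantity itself; it is absorbed because
    [(1 + eta) * (1 - eta / 2) >= 1]. *)
Lemma growth_step (eta P P' X : R) : 0 <= eta <= 1 -> 0 <= P' + X ->
  P' <= P + eta / 2 * (P' + X) -> P' + X <= (1 + eta) * (P + X).
Proof.
move=> /andP[e0 e1] q0 h.
have h1 : 0 <= eta * (1 - eta) * (P' + X) by rewrite !mulr_ge0 ?subr_ge0.
have h2 : (1 + eta) * (P' + X) <= (1 + eta) * (P + eta / 2 * (P' + X) + X).
  by rewrite ler_wpM2l ?addr_ge0// lerD2r.
lra.
Qed.

End BregmanConstant.

Section MethodConstants.
Variable R : realType.

(** With [p = m.+1], the factor [p.+1] of [model_real_le] times the bound [p.+1 ^+ p.+1] of
    [sub_Lp_le]. *)
Definition model_cst (m : nat) : R := m.+2%:R * m.+2%:R ^+ m.+2.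

Lemma model_cst_gt0 m : 0 < model_cst m.
Proof. by rewrite mulr_gt0 ?exprn_gt0 ?ltr0n. Qed.

Definition progress_step (m : nat) : R :=
  Num.min 1 (@unif_cvx R m / (4 * model_cst m)).

Lemma progress_step_spec m :
  0 < progress_step m <= 1 /\
  4 * model_cst m * progress_step m <= unif_cvx m.
Proof.
have K0 : 0 < 4 * model_cst m by rewrite mulr_gt0 ?model_cst_gt0.
rewrite /progress_step lt_min ltr01 divr_gt0 ?unif_cvx_gt0//= ge_min lexx.
by split=> //; rewrite mulrC -ler_pdivlMr// ge_min lexx orbT.
Qed.

Definition progress_rate (m : nat) : R := progress_step m / 2.

Lemma progress_rate_spec m : 0 < progress_rate m /\ progress_rate m <= 1.
Proof.
by have [/andP[? ?] _] := progress_step_spec m; rewrite /progress_rate; split; lra.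
Qed.

(** [expR 1] is the total growth of the potential, since [slack 0 = 1]; 130 leaves room for the
    initial potential and its shift, which contains the coefficient 128. *)
Definition rate_cst (m : nat) : R := expR 1 * (130 * bregman_cst m).

Lemma rate_cst_gt0 m : 0 < rate_cst m.
Proof.
rewrite /rate_cst mulr_gt0 ?expR_gt0// mulr_gt0//.
exact: lt_le_trans (bregman_cst_ge1 m).
Qed.

(** The 3 adds a divergence at [v_k] bounded by one potential bound and one at a near-minimizer
    bounded by two; see [scheme_next_dist]. *)
Definition far_cst (m : nat) : R :=
  2 ^+ m.+2 * (3 * rate_cst m * (4 ^+ m.+1 * m.+2%:R)).

(** The 2 accounts for the accuracy of the first step and for that of the near-minimizer, each at
    most [c]. *)
Definition first_step_cst (m : nat) : R := 2 + model_cst m * far_cst m.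

Lemma first_step_cst_ge2 m : 2 <= first_step_cst m.
Proof.
rewrite lerDl mulr_ge0 ?(ltW (model_cst_gt0 m))// /far_cst mulr_ge0 ?exprn_ge0//.
by apply: mulr_ge0; apply: mulr_ge0; rewrite ?exprn_ge0 ?ler0n ?(ltW (rate_cst_gt0 m)).
Qed.

(** Since [(d + c) / c >= 1], it may be raised to the power [m.+3] together with [k.+1]; the
    exponent then leaves the logarithm as a factor. *)
Lemma log_bound (m k : nat) (d c : R) : 0 <= d -> 0 < c ->
  ln (2 * (first_step_cst m * (d + c)) / (c / k.+1%:R ^+ m.+3))
   <= ln (2 * first_step_cst m) + m.+3%:R * ln (k.+1%:R * (d + c) / c).
Proof.
move=> d0 c0; have C2 := first_step_cst_ge2 m.
have k1 : 1 <= k.+1%:R :> R by rewrite ler1n.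
set u := (d + c) / c; have u1 : 1 <= u by rewrite ler_pdivlMr// mul1r lerDr.
rewrite -[k.+1%:R * (d + c) / c]mulrA -/u.
have X1 : 0 < k.+1%:R * u by rewrite mulr_gt0 ?(lt_le_trans ltr01).
have C0 : 0 < 2 * first_step_cst m by lra.
rewrite [m.+3%:R * _]mulr_natl -lnXn// -lnM ?posrE ?exprn_gt0//.
have kn : 0 < k.+1%:R ^+ m.+3 :> R by rewrite exprn_gt0 ?ltr0n.
rewrite (_ : _ / (c / k.+1%:R ^+ m.+3)
  = 2 * first_step_cst m * (k.+1%:R ^+ m.+3 * u)); last first.
  by rewrite /u; field; rewrite !gt_eqF.
have u0 : 0 < u := lt_le_trans ltr01 u1.
have L0 := mulr_gt0 C0 (mulr_gt0 kn u0).
have R0 := mulr_gt0 C0 (exprn_gt0 m.+3 X1).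
rewrite ler_ln ?posrE// ler_wpM2l ?(ltW C0)// exprMn ler_wpM2l ?(ltW kn)//.
by rewrite -[X in X <= _]expr1 ler_weXn2l.
Qed.

End MethodConstants.

(** * The accelerated scheme and its inner method *)

Section CompositeProblem.
Context {R : realType} {E : vectType R} (B : 'Hom(E, 'Hom(E, R^o))).
Variables (psi : E -> \bar R) (f : E -> R).
Hypotheses (psi_proper : eproper psi) (psi_convex : econvex psi)
  (f_convex : convex_function (edom psi) f).
Local Notation D := (edom psi).
Local Notation ps := (fun y => fine (psi y)).

Lemma psi_fin y : D y -> psi y = (fine (psi y))%:E.
Proof.
move=> Dy; rewrite fineK// fin_numE psi_proper.1 /=.
by move: Dy; rewrite /edom /=; case: (psi y).
Qed.

Lemma psi_pinfty y : ~ D y -> psi y = +oo%E.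
Proof.
by rewrite /edom /=; case: (psi y) => [r []||[]] //; rewrite ltry.
Qed.

Lemma segmentE (x y : E) (t : R) : x + t *: (y - x) = t *: y + (1 - t) *: x.
Proof. by rewrite scalerBl scale1r scalerBr addrCA. Qed.

Lemma edom_convex x y (t : R) : D x -> D y -> 0 <= t <= 1 ->
  D (x + t *: (y - x)).
Proof.
move=> Dx Dy t01; rewrite segmentE /edom /=.
apply: le_lt_trans (psi_convex y x t01) _.
by rewrite (psi_fin Dx) (psi_fin Dy) -!EFinM -EFinD ltry.
Qed.

Lemma fine_psi_convex x y (t : R) : D x -> D y -> 0 <= t <= 1 ->
  ps (x + t *: (y - x)) <= (1 - t) * ps x + t * ps y.
Proof.
move=> Dx Dy t01; have Dw := edom_convex Dx Dy t01.
rewrite -lee_fin -psi_fin// segmentE; apply: le_trans (psi_convex y x t01) _.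
by rewrite (psi_fin Dx) (psi_fin Dy) -!EFinM -EFinD addrC.
Qed.

Lemma smooth_convex x y (t : R) : D x -> D y -> 0 <= t <= 1 ->
  f (x + t *: (y - x)) <= (1 - t) * f x + t * f y.
Proof.
move=> Dx Dy /andP[t0 t1]; rewrite segmentE.
have /(_ y x) := f_convex (Itv01 t0 t1).
rewrite !inE => /(_ Dy Dx).
by rewrite convRE /= addrC.
Qed.

Definition Freal y : R := f y + fine (psi y).

Lemma composite_fin y : D y -> composite f psi y = (Freal y)%:E.
Proof. by move=> Dy; rewrite /composite (psi_fin Dy). Qed.

(** * One outer step *)

Section Step.
Variables (m : nat) (Lp : R) (x v : nat -> E) (k : nat).
Hypotheses (Lp0 : 0 < Lp) (Dxk : D (x k)).
Local Notation p := m.+1.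
Local Notation A := (accA p Lp k.+1).
Local Notation a := (acca p Lp k.+1).
Local Notation A0 := (accA p Lp k).
Local Notation pt := (acc_point p Lp x k).

Lemma accA_ge0 j : 0 <= accA p Lp j.
Proof. by rewrite /accA divr_ge0 ?exprn_ge0 ?ler0n// ltW. Qed.

Lemma acc_ratio01 : 0 <= a / A <= 1.
Proof.
have AA := accA_gt0 p k Lp0; have aa := acca_gt0 p k Lp0.
rewrite divr_ge0 ?(ltW AA) ?(ltW aa)//= ler_pdivrMr// mul1r /acca /=.
by rewrite lerBlDr lerDl accA_ge0.
Qed.

Lemma acc_pointE y : pt y = x k + (a / A) *: (y - x k).
Proof.
have AA := accA_gt0 p k Lp0.
rewrite segmentE /acc_point scalerDr !scalerA ![A^-1 * _]mulrC; congr (_ + _ *: _).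
by rewrite /acca /=; field; rewrite gt_eqF.
Qed.

Lemma edom_acc_point y : D y -> D (pt y).
Proof. by move=> Dy; rewrite acc_pointE; apply: edom_convex => //; exact: acc_ratio01. Qed.

Lemma acc_pointB y z : pt y - pt z = (a / A) *: (y - z).
Proof.
by rewrite !acc_pointE opprD addrACA subrr add0r -scalerBr opprB addrA subrK.
Qed.

(** The objective of the step without its Bregman term: the convex function [G] of the prox
    lemmas. *)
Definition sub_cvx y : R := sub_smooth p Lp f x k y + a * fine (psi y).

Lemma sub_cvx_convex y z (t : R) : D y -> D z -> 0 <= t <= 1 ->
  sub_cvx (y + t *: (z - y)) <= (1 - t) * sub_cvx y + t * sub_cvx z.
Proof.
move=> Dy Dz t01; rewrite /sub_cvx /sub_smooth.
have AA := accA_gt0 p k Lp0; have aa := acca_gt0 p k Lp0.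
have -> : pt (y + t *: (z - y)) = pt y + t *: (pt z - pt y).
  rewrite acc_pointB !acc_pointE -[RHS]addrA; congr (_ + _).
  by rewrite scalerA [t * _]mulrC -[(_ * t) *: _]scalerA -scalerDr addrAC.
have h1 := smooth_convex (edom_acc_point Dy) (edom_acc_point Dz) t01.
have h2 := fine_psi_convex Dy Dz t01.
have := lerD (ler_wpM2l (ltW AA) h1) (ler_wpM2l (ltW aa) h2).
by move=> /le_trans; apply; rewrite le_eqVlt; apply/orP; left; apply/eqP; ring.
Qed.

(** Convexity of [f] serves here, that of [psi] in [sub_cvx_ge]; the leftovers [A0 * f (x k)] and
    [A0 * fine (psi (x k))] recombine into [A0 * Freal (x k)] in [potential_step]. *)
Lemma sub_cvx_le y : D y -> sub_cvx y <= a * Freal y + A0 * f (x k).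
Proof.
move=> Dy; rewrite /sub_cvx /sub_smooth acc_pointE.
have AA := accA_gt0 p k Lp0.
have := ler_wpM2l (ltW AA) (smooth_convex Dxk Dy acc_ratio01).
rewrite (_ : A * (_ + _ * f y) = A0 * f (x k) + a * f y); last first.
  by rewrite /acca /=; field; rewrite gt_eqF.
rewrite /Freal; lra.
Qed.

Lemma sub_cvx_ge y : D y -> A * Freal (pt y) <= sub_cvx y + A0 * fine (psi (x k)).
Proof.
move=> Dy; rewrite /sub_cvx /sub_smooth /Freal acc_pointE.
have AA := accA_gt0 p k Lp0.
have := ler_wpM2l (ltW AA) (fine_psi_convex Dxk Dy acc_ratio01).
rewrite (_ : A * (_ + _ * fine (psi y))
  = A0 * fine (psi (x k)) + a * fine (psi y)); last first.
  by rewrite /acca /=; field; rewrite gt_eqF.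
lra.
Qed.

Hypothesis spB : sym_posdef B.
Local Notation breg := (prox_breg B m (x 0%N)).
Local Notation hr := (prox_obj B m (x 0%N) (v k) sub_cvx).
Local Notation phi := (sub_comp B p Lp psi x v k).

Definition sub_comp_real y : R := a * fine (psi y) + breg (v k) y.

Lemma sub_comp_fin y : D y -> phi y = (sub_comp_real y)%:E.
Proof.
by move=> Dy; rewrite /sub_comp (psi_fin Dy) bregman_prox.
Qed.

Lemma sub_comp_pinfty y : ~ D y -> phi y = +oo%E.
Proof.
move=> nDy; rewrite /sub_comp (psi_pinfty nDy) gt0_muley ?lte_fin ?acca_gt0//.
Qed.

Lemma edom_sub_comp y : edom phi y -> D y.
Proof.
by have [//|nDy] := pselect (D y); rewrite /edom /= sub_comp_pinfty.
Qed.

Lemma sub_obj_fin y : D y -> sub_obj B p Lp f psi x v k y = (hr y)%:E.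
Proof.
move=> Dy; rewrite /sub_obj /composite sub_comp_fin// -EFinD.
by rewrite /prox_obj /sub_cvx /sub_comp_real addrA.
Qed.

Lemma sub_obj_pinfty y : ~ D y -> sub_obj B p Lp f psi x v k y = +oo%E.
Proof. by move=> nDy; rewrite /sub_obj /composite sub_comp_pinfty. Qed.

Variable xs : E.
Hypothesis xs_sol : is_solution psi (composite f psi) xs.

Lemma Freal_min y : D y -> Freal xs <= Freal y.
Proof.
by move=> Dy; rewrite -lee_fin -(composite_fin xs_sol.1) -(composite_fin Dy) xs_sol.2.
Qed.

Lemma sub_obj_bounded y : D y -> A * Freal xs - A0 * fine (psi (x k)) <= hr y.
Proof.
move=> Dy; rewrite /prox_obj.
have := ler_wpM2l (accA_ge0 k.+1) (Freal_min (edom_acc_point Dy)).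
have := sub_cvx_ge Dy; have := prox_breg_ge0 spB m (x 0%N) (v k) y; lra.
Qed.

Definition sub_min : R := inf (hr @` D).

Lemma sub_min_le y : D y -> sub_min <= hr y.
Proof. exact: (inf_image_le Dxk sub_obj_bounded). Qed.

Lemma sub_min_adherent eps : 0 < eps -> exists2 y, D y & hr y < sub_min + eps.
Proof. exact: (inf_image_adherent Dxk sub_obj_bounded). Qed.

Lemma sub_obj_subopt e y :
  subopt (sub_obj B p Lp f psi x v k) e%:E y <-> D y /\ hr y <= sub_min + e.
Proof.
exact: (subopt_fin Dxk sub_obj_fin sub_obj_pinfty sub_obj_bounded).
Qed.

Lemma potential_step y e (t : R) : D y -> hr y <= sub_min + e -> 0 < t <= 1 ->
  A * (Freal (pt y) - Freal xs) + breg y xs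
   <= A0 * (Freal (x k) - Freal xs) + breg (v k) xs
      + (e / t + t * (m.+1%:R / 2
          * (Bnorm B (xs - y) + Bnorm B (xs - x 0%N)) ^+ m.+2)).
Proof.
move=> Dy hy t01.
have ymin z : D z -> hr y <= hr z + e.
  by move=> Dz; apply: le_trans hy _; rewrite lerD2r sub_min_le.
have := prox_obj_inexact_min spB edom_convex sub_cvx_convex Dy xs_sol.1 ymin t01.
have := sub_cvx_ge Dy; have := sub_cvx_le xs_sol.1.
have := prox_breg_ge0 spB m (x 0%N) (v k) y.
rewrite /prox_obj /Freal /acca /=; move: (e / t + _) => Y; lra.
Qed.

Lemma potential_growth c y (eta : R := slack k - slack k.+1)
    (X : R := 128 * bregman_cst m * c + Bnorm B (x 0%N - xs) ^+ m.+2) :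
  0 <= c -> D y -> hr y <= sub_min + c / k.+1%:R ^+ p.+2 ->
  A * (Freal (pt y) - Freal xs) + breg y xs + X
   <= (1 + eta) * (A0 * (Freal (x k) - Freal xs) + breg (v k) xs + X).
Proof.
move=> c0 Dy hy; have [eta0 eta1 eta3] := @slack_diff R k; rewrite -/eta in eta0 eta1 eta3.
have K1 : 1 <= bregman_cst m :> R := bregman_cst_ge1 m.
set K := bregman_cst m in X K1 *; have K0 : 0 < K by apply: lt_le_trans K1.
set D0 := _ ^+ m.+2 in X *; have D00 : 0 <= D0 by rewrite exprn_ge0 ?Bnorm_ge0.
have X0 : 0 <= X by rewrite addr_ge0// mulr_ge0// mulr_ge0// ltW.
(* This [t] makes the smoothness error [eta / 2] times the new potential plus [D0]; the inexactness
   error becomes [eta / 2 * (128 * K * c)], which is where 128 comes from. *)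
have t01 : 0 < eta / (2 * K) <= 1.
  have K2 : 0 < 2 * K by rewrite mulr_gt0.
  by apply/andP; split; [rewrite divr_gt0|rewrite ler_pdivrMr//; lra].
have := potential_step Dy hy t01; set t := eta / _; set e := c / _.
set P' := A * _ + _; set P := _ + breg (v k) xs; set Y := _ * _ ^+ m.+2.
have b0 := prox_breg_ge0 spB m (x 0%N) y xs.
have P'b : breg y xs <= P'.
  rewrite lerDr mulr_ge0 ?accA_ge0// subr_ge0.
  by apply: Freal_min; exact: edom_acc_point.
have hY : Y <= K * (breg y xs + D0).
  have := @bregman_cst_le _ _ B m (x 0%N) y xs D0 (Bnorm B (xs - x 0%N)) spB.
  by apply; rewrite ?Bnorm_ge0// /D0 BnormB.
have htY : t * Y <= eta / 2 * (P' + D0).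
  have t0 : 0 <= t by case/andP: t01 => /ltW.
  apply: le_trans (ler_wpM2l t0 hY) _; rewrite mulrA /t.
  have -> : eta / (2 * K) * K = eta / 2 by field; rewrite gt_eqF.
  by rewrite ler_wpM2l ?divr_ge0 ?(ltW eta0)// lerD2r.
have het : e / t <= eta / 2 * (128 * K * c).
  (* The exponent [p.+2] is at least 3, the decay that [slack_diff] handles. *)
  have he : e <= 32 * eta ^+ 2 * c.
    rewrite /e mulrC ler_wpM2r//; apply: le_trans eta3.
    rewrite lef_pV2 ?posrE ?exprn_gt0 ?ltr0n// ler_weXn2l ?ler1n//.
  have -> : e / t = e * (2 * K / eta) by rewrite /t; field; rewrite !gt_eqF.
  apply: le_trans (ler_wpM2r _ he) _; first by rewrite divr_ge0 ?(ltW eta0)// mulr_ge0// ltW.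
  by rewrite le_eqVlt; apply/orP; left; apply/eqP; field; rewrite gt_eqF.
move=> h; apply: growth_step; first by rewrite ltW.
  by rewrite addr_ge0// (le_trans b0).
move: h htY het; rewrite /X; move: (e / t) (t * Y) => *; lra.
Qed.

(** * The tensor model of the subproblem *)

Section Model.
Variables (Df : E -> seq E -> R).
Hypotheses (dD : derivatives_on B D p f Df)
  (lD : lipschitz_derivative B D p Df Lp).
Local Notation g := (sub_smooth p Lp f x k).
Local Notation Dg := (sub_smooth_D p Lp Df x k).
Local Notation Lg := (sub_Lp p Lp k).
Local Notation nrm := (Bnorm B).

Lemma sub_Lp_ge0 : 0 <= Lg.
Proof.
have aa := acca_gt0 p k Lp0.
by rewrite /sub_Lp mulr_ge0 ?divr_ge0 ?exprn_ge0 ?accA_ge0 ?(ltW aa) ?(ltW Lp0).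
Qed.

(** The choice of [accA] makes [Lp] cancel, and [(k+1)^(p+1) - k^(p+1) <= (p+1) (k+1)^p] makes the
    powers of [k+1] cancel. *)
Lemma sub_Lp_le : Lg <= p.+1%:R ^+ p.+1.
Proof.
have k0 : 0 < k.+1%:R :> R by rewrite ltr0n.
set al : R := k.+1%:R ^+ p.+1 - k%:R ^+ p.+1.
have al0 : 0 <= al by rewrite subr_ge0 lerXn2r ?nnegrE ?ler0n// ler_nat.
have ale : al <= p.+1%:R * k.+1%:R ^+ p.
  have h1 : 0 <= (k.+1%:R : R) <= k.+1%:R by rewrite ler0n lexx.
  have h2 : 0 <= (k%:R : R) <= k.+1%:R by rewrite ler0n ler_nat leqnSn.
  have := subXX_le p h1 h2; rewrite (_ : k.+1%:R - k%:R = 1) -/al.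
    by rewrite mul1r expr1n mulr1.
  by rewrite -natr1 addrAC subrr add0r.
have -> : Lg = al ^+ p.+1 / (k.+1%:R ^+ p) ^+ p.+1.
  rewrite /sub_Lp /acca /accA /= -mulrBl -/al !expr_div_n -!exprM mulnC.
  have l0 : Lp ^+ p != 0 by rewrite gt_eqF ?exprn_gt0.
  have k1 : k.+1%:R ^+ (p * p.+1) != 0 :> R by rewrite gt_eqF ?exprn_gt0.
  by rewrite [Lp ^+ p.+1]exprS; field; rewrite l0 k1 gt_eqF.
by rewrite ler_pdivrMr ?exprn_gt0// -exprMn lerXn2r ?nnegrE// (le_trans al0).
Qed.

Lemma sub_smooth_taylor z y : D z -> D y ->
  `|g y - (g z + \sum_(1 <= i < p.+1) Dg z (nseq i (y - z)) / i`!%:R)|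
    <= Lg * nrm (y - z) ^+ p.+1 / p.+1`!%:R.
Proof.
move=> Dz Dy; have AA := accA_gt0 p k Lp0.
have := taylor_lipschitz spB dD lD edom_convex (edom_acc_point Dz) (edom_acc_point Dy).
rewrite acc_pointB Bnorm_homog [`|a / A|]ger0_norm ?(andP acc_ratio01).1//.
have normA (u : R) : A * `|u| = `|A * u| by rewrite normrM gtr0_norm.
move=> /(ler_wpM2l (ltW AA)); rewrite normA mulrBr mulrDr big_distrr /=.
rewrite (_ : A * (Lp * _ / _) = Lg * nrm (y - z) ^+ p.+1 / p.+1`!%:R); last first.
  rewrite /sub_Lp exprMn expr_div_n [A ^+ p.+1]exprS; field.
  by rewrite !gt_eqF ?exprn_gt0 ?ltr0n ?fact_gt0.
congr (`|_ - (_ + _)| <= _); apply: eq_bigr => i _.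
by rewrite /sub_smooth_D map_nseq mulrA.
Qed.

Definition model_real z y : R :=
  g z + (\sum_(1 <= i < p.+1) Dg z (nseq i (y - z)) / i`!%:R)
    + p%:R * Lg * nrm (y - z) ^+ p.+1 / p.+1`!%:R + sub_comp_real y.

(** The regularizer is [p >= 1] times the Taylor error bound and hence dominates the error. *)
Lemma model_real_ge z y : D z -> D y -> hr y <= model_real z y.
Proof.
move=> Dz Dy; have := sub_smooth_taylor Dz Dy; set S := \sum_(_ <= _ < _) _.
rewrite ler_norml => /andP[_]; set W := Lg * _ / _ => h.
have W0 : 0 <= W.
  by rewrite /W divr_ge0 ?ler0n// mulr_ge0 ?sub_Lp_ge0// exprn_ge0 ?Bnorm_ge0.
rewrite /model_real -/S (_ : _ * Lg * _ / _ = p%:R * W); last by rewrite /W !mulrA.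
have : W <= p%:R * W by rewrite ler_peMl// ler1n.
rewrite /prox_obj /sub_cvx /sub_comp_real; move: h; lra.
Qed.

Lemma model_real_le z y : D z -> D y ->
  model_real z y <= hr y + p.+1%:R * Lg * nrm (y - z) ^+ p.+1.
Proof.
move=> Dz Dy; have := sub_smooth_taylor Dz Dy; set S := \sum_(_ <= _ < _) _.
rewrite ler_norml => /andP[]; set W := Lg * _ / _ => h _.
have W1 : W <= Lg * nrm (y - z) ^+ p.+1.
  rewrite ler_piMr ?invf_le1 ?ltr0n ?fact_gt0 ?ler1n ?fact_gt0//.
  by rewrite mulr_ge0 ?sub_Lp_ge0 ?exprn_ge0 ?Bnorm_ge0.
rewrite /model_real -/S (_ : _ * Lg * _ / _ = p%:R * W); last by rewrite /W !mulrA.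
have : (p%:R + 1) * W <= p.+1%:R * (Lg * nrm (y - z) ^+ p.+1).
  by rewrite natr1 ler_wpM2l ?ler0n.
rewrite /prox_obj /sub_cvx /sub_comp_real; move: h; lra.
Qed.

Local Notation model := (tensor_model B p (p%:R * Lg) g Dg phi).

Lemma model_fin z y : D y -> model z y = (model_real z y)%:E.
Proof. by move=> Dy; rewrite /tensor_model sub_comp_fin// -EFinD -!addrA. Qed.

Lemma model_pinfty z y : ~ D y -> model z y = +oo%E.
Proof. by move=> nDy; rewrite /tensor_model sub_comp_pinfty. Qed.

Lemma model_bounded z y : D z -> D y ->
  A * Freal xs - A0 * fine (psi (x k)) <= model_real z y.
Proof.
by move=> Dz Dy; apply: le_trans (sub_obj_bounded Dy) (model_real_ge Dz Dy).
Qed.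

Lemma tensor_step_real del z M : D z ->
  tensor_step B p (p%:R * Lg) g Dg phi del%:E z M <->
  [/\ D M, model_real z M <= inf (model_real z @` D) + del & hr M < hr z].
Proof.
move=> Dz; have sub := subopt_fin Dxk (@model_fin z) (@model_pinfty z)
  (fun y => model_bounded Dz).
have lt M' : D M' -> (sub_obj B p Lp f psi x v k M' < sub_obj B p Lp f psi x v k z)%E
    = (hr M' < hr z).
  by move=> DM; rewrite !sub_obj_fin// lte_fin.
split=> [[/edom_sub_comp DM /sub[_ h]]|[DM h1 h2]].
  by rewrite -/(sub_obj B p Lp f psi x v k) lt.
split; first by rewrite /edom /= sub_comp_fin// ltry.
- exact/sub.
- by rewrite -/(sub_obj B p Lp f psi x v k) lt.
Qed.

End Model.

End Step.

(** * The outer iterations *)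

Section Scheme.
Variables (m : nat) (Lp : R) (xs : E) (c : R) (zeta : nat -> R).
Variables (x v : nat -> E) (n : nat).
Local Notation p := m.+1.
Hypotheses (spB : sym_posdef B) (Lp0 : 0 < Lp)
  (xs_sol : is_solution psi (composite f psi) xs) (c0 : 0 <= c)
  (zetaE : forall k, (1 <= k)%N -> zeta k = c / k%:R ^+ p.+2)
  (sch : accelerated_scheme B p Lp f psi zeta n x v).
Local Notation breg := (prox_breg B m (x 0%N)).
Local Notation D0 := (Bnorm B (x 0%N - xs) ^+ p.+1).

Lemma scheme_edom k : (k <= n)%N -> D (x k) /\ D (v k).
Proof.
have [Dx0 v0 step] := sch; elim: k => [|k ih] kn; first by rewrite v0.
have [Dxk _] := ih (ltnW kn).
have [/(sub_obj_subopt m v Lp0 Dxk spB xs_sol)[Dv _] ->] := step _ kn.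
by split=> //; exact: edom_acc_point.
Qed.

Definition potential k : R :=
  accA p Lp k * (Freal (x k) - Freal xs) + breg (v k) xs.

(** Adding it to the potential turns the additive errors of the steps into relative ones. *)
Definition potential_shift : R := 128 * bregman_cst m * c + D0.

Lemma dist0_ge0 : 0 <= D0.
Proof. by rewrite exprn_ge0 ?Bnorm_ge0. Qed.

Lemma potential_shift_ge0 : 0 <= potential_shift.
Proof.
by rewrite addr_ge0 ?dist0_ge0// mulr_ge0// mulr_ge0// (le_trans ler01) ?bregman_cst_ge1.
Qed.

Lemma potential_ge k : (k <= n)%N ->
  accA p Lp k * (Freal (x k) - Freal xs) <= potential k /\
  breg (v k) xs <= potential k.
Proof.
move=> /scheme_edom[Dx _]; split; first by rewrite /potential lerDl prox_breg_ge0.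
by rewrite /potential lerDr mulr_ge0 ?(accA_ge0 m Lp0)// subr_ge0; exact: (Freal_min xs_sol).
Qed.

Lemma shifted_potential_le k : (k <= n)%N ->
  potential k + potential_shift <= rate_cst R m * (D0 + c).
Proof.
move=> kn; have [_ v0 step] := sch; have X0 := potential_shift_ge0.
have K1 : 1 <= bregman_cst m :> R := bregman_cst_ge1 m.
have pge j : (j <= k)%N -> 0 <= potential j + potential_shift.
  move=> jk; rewrite addr_ge0//; apply: le_trans (potential_ge (leq_trans jk kn)).2.
  exact: prox_breg_ge0.
have := @expR_product_bound R (fun j => potential j + potential_shift) slack k
  (pge 0%N (leq0n k)) slack_ge0 _ pge.
rewrite (_ : slack 0%N = 1 :> R) => [bound|]; last by rewrite /slack sqrtr1 invr1.
(* As [accA] vanishes at 0 and [v 0 = x 0], only [d xs], which is [D0 / p.+1], remains. *)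
have p0 : potential 0%N <= D0.
  rewrite /potential /accA expr0n /= !mul0r add0r v0 /prox_breg /prox_grad /prox.
  rewrite subrr Bform0l mulr0 Bnorm0 expr0n /= mul0r !subr0 BnormB.
  by rewrite ler_piMr ?dist0_ge0// invf_le1 ?ltr0n ?ler1n.
apply: le_trans (bound _) _ => [j jk|].
  have jn := leq_trans jk kn; have [Dx _] := scheme_edom (ltnW jn).
  have [sub xE] := step _ jn.
  move/(sub_obj_subopt m v Lp0 Dx spB xs_sol): sub => [Dv hv].
  rewrite zetaE// in hv; rewrite /potential xE.
  exact: (potential_growth Lp0 Dx spB xs_sol c0 Dv hv).
rewrite /rate_cst -[leRHS]mulrA ler_wpM2l ?expR_ge0//.
have D00 := dist0_ge0; move: p0; rewrite /potential_shift.
have : D0 <= bregman_cst m * D0 by rewrite ler_peMl.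
have : 0 <= bregman_cst m * D0 by rewrite mulr_ge0// (le_trans ler01).
have : 0 <= bregman_cst m * c by rewrite mulr_ge0// (le_trans ler01).
rewrite -(mulrA _ (bregman_cst m) c) -(mulrA _ (bregman_cst m) (D0 + c)) mulrDr.
move: (bregman_cst m * D0) (bregman_cst m * c) (potential 0%N) D0 => *; lra.
Qed.

Lemma potential_le k : (k <= n)%N ->
  potential k <= rate_cst R m * (D0 + c).
Proof.
move=> /shifted_potential_le; apply: le_trans; rewrite lerDl; exact: potential_shift_ge0.
Qed.

Lemma scheme_rate k : (1 <= k)%N -> (k <= n)%N ->
  Freal (x k) - Freal xs
   <= rate_cst R m * (Lp * (D0 + c) / k%:R ^+ p.+1).
Proof.
move=> k0 kn; have := le_trans (potential_ge kn).1 (potential_le kn).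
have kp : 0 < (k%:R : R) ^+ p.+1 by rewrite exprn_gt0// ltr0n.
rewrite mulrC /accA -ler_pdivlMr ?divr_gt0// => /le_trans; apply.
by rewrite invf_div le_eqVlt; apply/orP; left; apply/eqP; ring.
Qed.

(** Any sufficiently accurate [y] could serve as the next [v], so [potential_growth] bounds its
    divergence to [xs]; both [y] and [v n] are then close to [xs]. *)
Lemma scheme_next_dist y : D y ->
  subopt (sub_obj B p Lp f psi x v n) (c / n.+1%:R ^+ p.+2)%:E y ->
  Bnorm B (y - v n) ^+ p.+1
   <= far_cst R m * (D0 + c).
Proof.
move=> Dy; have [Dx Dv] := scheme_edom (leqnn n).
move/(sub_obj_subopt m v Lp0 Dx spB xs_sol) => [_ hy].
have := potential_growth Lp0 Dx spB xs_sol c0 Dy hy.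
have [eta0 eta1 _] := @slack_diff R n; rewrite -/(potential n) -/potential_shift.
have Dpt := edom_acc_point m Lp0 Dx Dy.
have gap0 : 0 <= accA p Lp n.+1 * (Freal (acc_point p Lp x n y) - Freal xs).
  by rewrite mulr_ge0 ?(accA_ge0 m Lp0)// subr_ge0; exact: Freal_min.
have b0 := prox_breg_ge0 spB m (x 0%N) (v n) xs.
have X0 := potential_shift_ge0; have P0 := (potential_ge (leqnn n)).2.
have PT := shifted_potential_le (leqnn n); set T := _ * (D0 + c) in PT *.
set Q := potential n + potential_shift in PT *.
have Q0 : 0 <= Q by rewrite addr_ge0// (le_trans b0).
have : (1 + (slack n - slack n.+1)) * Q <= 2 * Q by rewrite ler_wpM2r//; lra.
move=> h1 h2; have hby : breg y xs <= 2 * T by lra.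
have hbv : breg (v n) xs <= T by rewrite /Q in PT; lra.
set S : R := 4 ^+ p * p.+1%:R.
have S0 : 0 <= S by rewrite mulr_ge0 ?exprn_ge0 ?ler0n.
have dy : Bnorm B (y - xs) ^+ p.+1 <= S * (2 * T).
  by rewrite BnormB; apply: le_trans (bregman_dist m (x 0%N) _ _ spB) _; rewrite ler_wpM2l.
have dv : Bnorm B (xs - v n) ^+ p.+1 <= S * T.
  by apply: le_trans (bregman_dist m (x 0%N) _ _ spB) _; rewrite ler_wpM2l.
apply: (@le_trans _ _ ((Bnorm B (y - xs) + Bnorm B (xs - v n)) ^+ p.+1)).
  rewrite lerXn2r ?nnegrE ?addr_ge0 ?Bnorm_ge0//.
  rewrite (_ : y - v n = (y - xs) + (xs - v n)) ?Bnorm_triangle//.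
  by rewrite addrA subrK.
apply: le_trans (exprD_le _ (Bnorm_ge0 _ _) (Bnorm_ge0 _ _)) _.
apply: (@le_trans _ _ (2 ^+ p.+1 * (S * (2 * T) + S * T))).
  by rewrite ler_wpM2l ?exprn_ge0// lerD.
by rewrite /far_cst /T /S le_eqVlt; apply/orP; left; apply/eqP; ring.
Qed.

(** * Step count of the inner method *)

Section InnerMethod.
Variables (Df : E -> seq E -> R).
Hypotheses (cpos : 0 < c) (dD : derivatives_on B D p f Df)
  (lD : lipschitz_derivative B D p Df Lp).
Local Notation g := (sub_smooth p Lp f x n).
Local Notation Dg := (sub_smooth_D p Lp Df x n).
Local Notation phi := (sub_comp B p Lp psi x v n).
Local Notation Lg := (sub_Lp p Lp n).
Local Notation hr := (prox_obj B m (x 0%N) (v n) (sub_cvx m Lp x n)).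
Local Notation hs := (sub_min m Lp x v n).
Local Notation model := (model_real m Lp x v n Df).
Local Notation q := (progress_rate R m).
Local Notation zeta1 := (c / n.+1%:R ^+ p.+2).

Let Dxn : D (x n) := (scheme_edom (leqnn n)).1.

Let zeta1_gt0 : 0 < zeta1.
Proof. by rewrite divr_gt0// exprn_gt0 ?ltr0n. Qed.

Lemma inner_progress z : D z -> hs < hr z ->
  exists2 w, D w & model z w <= hs + (1 - q) * (hr z - hs).
Proof.
move=> Dz hz; have [a01 a_small] := progress_step_spec R m.
apply: (tensor_progress spB edom_convex (sub_cvx_convex m Lp0 Dxn)
  (sub_min_le m v Lp0 Dxn spB xs_sol)
  (sub_min_adherent m v Lp0 Dxn spB xs_sol)
  (model_real_le v Lp0 Dxn spB dD lD) Dz) => //.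
  by rewrite mulr_ge0 ?ler0n ?sub_Lp_ge0.
apply: le_trans a_small; rewrite ler_wpM2r//; first by case/andP: a01 => /ltW.
by rewrite ler_wpM2l// ler_wpM2l ?ler0n// sub_Lp_le.
Qed.

Lemma inner_run (c' : R) (N : nat) (z : nat -> E) : 0 < c' <= q / 4 ->
  tensor_run B p (p%:R * Lg) g Dg phi c' c zeta1 (v n) N z ->
  N%:R <= 3 + 2 / q * ln (2 * (first_step_cst R m * (D0 + c)) / zeta1) /\
  (subopt (composite g phi) zeta1%:E (z N) \/
   exists M, tensor_step B p (p%:R * Lg) g Dg phi
     (tensor_accuracy g phi c' c z N) (z N) M).
Proof.
move=> /andP[c'0 c'q] [z0 run]; have [q0 q1] := progress_rate_spec R m.
have Dvn : D (v n) := (scheme_edom (leqnn n)).2.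
have Dz j : (j <= N)%N -> D (z j).
  case: j => [|j] jN; first by rewrite z0.
  by have [_ [/(edom_sub_comp Lp0)]] := run _ jN.
pose del j : R := if j is i.+1 then c' * (hr (z i) - hr (z i.+1)) else c.
have accE j : (j <= N)%N -> tensor_accuracy g phi c' c z j = (del j)%:E.
  case: j => [//|i] iN; have Dz1 := Dz _ iN; have Dz2 := Dz _ (ltnW iN).
  by rewrite /tensor_accuracy -/(sub_obj B p Lp f psi x v n) !sub_obj_fin.
have step j : (j < N)%N -> [/\ D (z j.+1),
    model (z j) (z j.+1) <= inf (model (z j) @` D) + del j & hr (z j.+1) < hr (z j)].
  move=> jN; have [_] := run _ jN; rewrite accE ?(ltnW jN)//.
  by move/(tensor_step_real v Lp0 Dxn spB xs_sol dD lD) => /(_ (Dz _ (ltnW jN))).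
have nopt j : (j <= N)%N -> ~ subopt (composite g phi) zeta1%:E (z j) ->
    hs + zeta1 < hr (z j).
  move=> jN nsub; rewrite ltNge; apply/negP => h; apply: nsub.
  by apply/(sub_obj_subopt m v Lp0 Dxn spB xs_sol); split=> //; exact: Dz.
have infle w y : D w -> D y -> inf (model w @` D) <= model w y.
  move=> Dw; apply: (inf_image_le Dxn) => u.
  exact: (model_bounded v Lp0 Dxn spB xs_sol dD lD Dw).
have modge w y : D w -> D y -> hr y <= model w y.
  exact: (model_real_ge v Lp0 Dxn spB dD lD).
split.
  pose r j := hr (z j) - hs.
  apply: (@inexact_descent_count R N r zeta1 _ q c') => //.
  - rewrite mulrA; apply: (@le_trans _ _ c).
      by rewrite ler_pdivrMr ?exprn_gt0 ?ltr0n// ler_peMr ?(ltW cpos)// exprn_ege1 ?ler1n.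
    have C1 := first_step_cst_ge2 R m; have D00 := dist0_ge0.
    have h1 : 1 <= 2 * first_step_cst R m by lra.
    have h2 : c <= D0 + c by rewrite lerDr.
    by rewrite -[X in X <= _]mul1r; exact: ler_pM.
  - by rewrite q0.
  - by rewrite (ltW c'0).
  - by move=> j jN; rewrite /r ltrBrDl nopt ?(ltnW jN)//; case: (run _ jN).
  - by move=> j /step[_ _ /ltW]; rewrite /r lerD2r.
  (* The residual of the starting point is unbounded, so the first step is compared with a
     near-minimizer at controlled distance instead of with [z 0]. *)
  - move=> /step[Dz1 hz1 _].
    have [y Dy hy] := sub_min_adherent m v Lp0 Dxn spB xs_sol zeta1_gt0.
    have suby : subopt (sub_obj B p Lp f psi x v n) zeta1%:E y.
      by apply/(sub_obj_subopt m v Lp0 Dxn spB xs_sol); split=> //; exact: ltW.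
    have dist := scheme_next_dist Dy suby.
    have h1 := modge _ _ (Dz _ (leq0n N)) Dz1; have h2 := infle _ _ (Dz _ (leq0n N)) Dy.
    have h3 := model_real_le v Lp0 Dxn spB dD lD (Dz _ (leq0n N)) Dy.
    have zc : zeta1 <= c.
      by rewrite ler_pdivrMr ?exprn_gt0 ?ltr0n// ler_peMr ?(ltW cpos)// exprn_ege1 ?ler1n.
    have Lg0 := sub_Lp_ge0 m n Lp0; have Lg1 := sub_Lp_le m n Lp0.
    rewrite z0 in h1 h2 h3 hz1.
    have h4 : p.+1%:R * Lg * Bnorm B (y - v n) ^+ p.+1
        <= model_cst R m * (far_cst R m * (D0 + c)).
      apply: ler_pM => //; first by rewrite mulr_ge0 ?ler0n.
        by rewrite exprn_ge0 ?Bnorm_ge0.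
      by rewrite /model_cst ler_wpM2l ?ler0n.
    have D00 := dist0_ge0; rewrite /r /first_step_cst mulrDl -mulrA.
    move: hz1; rewrite /del /=; lra.
  - move=> j jN; have [Dz2 hz2 _] := step _ jN.
    have Dz1 := Dz _ (ltnW jN).
    have hz : hs < hr (z j.+1).
      apply: lt_trans (nopt _ (ltnW jN) (run _ jN).1); rewrite ltrDl; exact: zeta1_gt0.
    have [w Dw hw] := inner_progress Dz1 hz.
    have h1 := modge _ _ Dz1 Dz2; have h2 := infle _ _ Dz1 Dw.
    by move: hz2; rewrite /r /del; lra.
have [?|nsub] := pselect (subopt (composite g phi) zeta1%:E (z N)); [by left|right].
have DzN := Dz _ (leqnn N).
have hz : hs < hr (z N).
  apply: lt_trans (nopt _ (leqnn N) nsub); rewrite ltrDl; exact: zeta1_gt0.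
have [w Dw hw] := inner_progress DzN hz.
have delN : 0 < del N.
  rewrite /del; case: N step {run Dz accE nopt nsub DzN hz hw} => [//|i] step.
  by have [_ _ h] := step _ (ltnSn i); rewrite mulr_gt0// subr_gt0.
(* The first bound gives the prescribed accuracy. The second forces a strict decrease, since the
   infimum of the model is at most [hs + (1 - q) * (hr (z N) - hs)]. *)
have e0 : 0 < Num.min (del N) (q * (hr (z N) - hs)).
  by rewrite lt_min delN mulr_gt0// subr_gt0.
have [M DM hM] := inf_image_adherent Dxn
  (fun u => model_bounded v Lp0 Dxn spB xs_sol dD lD DzN) e0.
exists M; rewrite accE//; apply/(tensor_step_real v Lp0 Dxn spB xs_sol dD lD) => //.
have h1 := modge _ _ DzN DM; have h2 := infle _ _ DzN Dw.
split=> //.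
  by apply: le_trans (ltW hM) _; rewrite lerD2l ge_min lexx.
apply: le_lt_trans h1 _; apply: lt_le_trans hM _.
have : Num.min (del N) (q * (hr (z N) - hs)) <= q * (hr (z N) - hs).
  by rewrite ge_min lexx orbT.
lra.
Qed.

End InnerMethod.
End Scheme.

End CompositeProblem.

(** Every run that has not stopped earlier has bounded length, and it either ends at an accurate
    point or can be continued; together these force the inner method to stop within the bound. *)
Theorem theorem6 (R : realType) (p : nat) (hp : (1 <= p)%N) :
  exists C : R, 0 < C /\
  forall (E : vectType R) (B : 'Hom(E, 'Hom(E, R^o)))
    (psi : E -> \bar R) (f : E -> R) (Df : E -> seq E -> R)
    (Lp : R) (xstar : E) (c : R) (zeta : nat -> R),
    sym_posdef B ->
    eproper psi -> closed_epigraph B psi -> econvex psi ->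
    convex_function (edom psi) f ->
    derivatives_on B (edom psi) p f Df ->
    0 < Lp -> lipschitz_derivative B (edom psi) p Df Lp ->
    is_solution psi (composite f psi) xstar ->
    0 <= c ->
    (forall k, (1 <= k)%N -> zeta k = c / k%:R ^+ p.+2) ->
    forall x v : nat -> E,
    (forall k, (1 <= k)%N ->
       accelerated_scheme B p Lp f psi zeta k x v ->
       (composite f psi (x k) - composite f psi xstar
          <= (C * (Lp * (Bnorm B (x 0%N - xstar) ^+ p.+1 + c)
                     / k%:R ^+ p.+1))%:E)%E)
    /\
    (0 < c -> forall k,
       accelerated_scheme B p Lp f psi zeta k x v ->
       let g := sub_smooth p Lp f x k in
       let Dg := sub_smooth_D p Lp Df x k in
       let phi := sub_comp B p Lp psi x v k in
       let H := p%:R * sub_Lp p Lp k in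
       exists c' delta1 : R,
         [/\ 0 < c' < p%:R / p.+1%:R * sub_omega p Lp k `^ (- p%:R^-1),
             0 < delta1 &
             forall (n : nat) (z : nat -> E),
               tensor_run B p H g Dg phi c' delta1 (zeta k.+1) (v k) n z ->
               n%:R <= C * (1 + ln (k.+1%:R
                   * (Bnorm B (x 0%N - xstar) ^+ p.+1 + c) / c)) /\
               (subopt (composite g phi) (zeta k.+1)%:E (z n) \/
                exists M : E, tensor_step B p H g Dg phi
                  (tensor_accuracy g phi c' delta1 z n) (z n) M)]).
Proof.
case: p hp => [//|m] _.
have [q0 _] := progress_rate_spec R m; have r0 := rate_cst_gt0 R m.
have lF : 0 <= ln (2 * first_step_cst R m).
  by rewrite ln_ge0//; have := first_step_cst_ge2 R m; lra.
have q2 : 0 < 2 / progress_rate R m by rewrite divr_gt0.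
(* Sum of the coefficients left once [log_bound] is inserted in the step count; it is then added to
   [rate_cst] so that one constant serves both claims. *)
set N : R := 3 + 2 / progress_rate R m * (ln (2 * first_step_cst R m) + m.+3%:R).
have N0 : 0 < N.
  have : 0 <= 2 / progress_rate R m * (ln (2 * first_step_cst R m) + m.+3%:R).
    by rewrite mulr_ge0 ?(ltW q2)// addr_ge0 ?ler0n.
  rewrite /N; lra.
exists (rate_cst R m + N); split; first exact: addr_gt0.
move=> E B psi f Df Lp xs c zeta spB psiP _ psiC fC dD Lp0 lD sol c0 zE x v.
split.
  move=> k k1 sch.
  have [Dx _] := scheme_edom psiP psiC spB Lp0 sol sch (leqnn k).
  rewrite (composite_fin f psiP Dx) (composite_fin f psiP sol.1) -EFinB lee_fin.
  apply: le_trans (scheme_rate psiP psiC fC spB Lp0 sol c0 zE sch k1 (leqnn k)) _.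
  rewrite ler_wpM2r ?lerDl ?(ltW N0)// divr_ge0 ?exprn_ge0 ?ler0n//.
  by rewrite mulr_ge0 ?(ltW Lp0)// addr_ge0 ?exprn_ge0 ?Bnorm_ge0.
move=> cpos k sch g Dg phi H.
have om0 : 0 < sub_omega m.+1 Lp k `^ (- m.+1%:R^-1).
  by rewrite powR_gt0// /sub_omega lt_max ltr01 orbT.
set b := m.+1%:R / m.+2%:R * _; have b0 : 0 < b by rewrite mulr_gt0 ?divr_gt0 ?ltr0n.
(* The count requires [c' <= q / 4], where [q] is [progress_rate R m], and the method requires
   [c' < b], ensured by halving [b]. With [delta1 = c] the residual after the first step remains a
   multiple of [D0 + c], for [D0] the initial distance to the power [p.+1]. *)
exists (Num.min (progress_rate R m / 4) (b / 2)), c.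
have c'0 : 0 < Num.min (progress_rate R m / 4) (b / 2).
  by rewrite lt_min; apply/andP; split; [lra|exact: divr_gt0].
split=> //.
  rewrite c'0 /=; apply: (@le_lt_trans _ _ (b / 2)); first by rewrite ge_min lexx orbT.
  lra.
move=> n z; rewrite zE// => run.
have c'q : 0 < Num.min (progress_rate R m / 4) (b / 2) <= progress_rate R m / 4.
  by rewrite c'0 ge_min lexx.
have [cnt ex] := inner_run psiP psiC fC spB Lp0 sol c0 zE sch cpos dD lD c'q run.
split=> //; apply: le_trans cnt _.
have D00 : 0 <= Bnorm B (x 0%N - xs) ^+ m.+2 by rewrite exprn_ge0 ?Bnorm_ge0.
have := ler_wpM2l (ltW q2) (log_bound m k D00 cpos).
set X := ln (k.+1%:R * _ / c); set Y := ln (_ / (c / _)).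
have X0 : 0 <= X.
  rewrite ln_ge0// ler_pdivlMr// mul1r; apply: (@le_trans _ _ (1 * c)).
    by rewrite mul1r.
  by apply: ler_pM => //; rewrite ?ler1n// lerDr.
have e1 := mulr_ge0 (ltW r0) X0.
have e2 := mulr_ge0 (mulr_ge0 (ltW q2) lF) X0.
have e3 := mulr_ge0 (ltW q2) (ler0n R m.+3).
rewrite /N; move: r0 e1 e2 e3 lF X0 q2 {om0 b0 c'0 c'q run N0 N}.
move: (2 / _) (ln (2 * _)) X Y (rate_cst R m) (m.+3%:R) => s l X Y r w.
by move=> *; lra.
Qed.
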